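(* Let $X$ be a countable set, let $\mathcal{A}$ and $\mathcal{B}$ be unital $C^*$-algebras, and suppose that $\mathcal{B}$ is injective. Then every completely bounded kernel $k : X\times X\to \mathcal{L}(\mathcal{A},\mathcal{B})$ has a Kolmogorov decomposition.
   Context: $\mathcal{L}(\mathcal{A},\mathcal{B})$ is the space of bounded linear maps from $\mathcal{A}$ to $\mathcal{B}$; a kernel on $X$ is a function $k: X\times X\to\mathcal{L}(\mathcal{A},\mathcal{B})$, and $k(x,y)[a]$ denotes the value of the map $k(x,y)$ at $a\in\mathcal{A}$. For a finite subset $F=\{x_1,\dots,x_n\}\subset X$, the entrywise map $(k(x_i,x_j)): M_n(\mathcal{A})\to M_n(\mathcal{B})$ is $(a_{i,j})\mapsto (k(x_i,x_j)[a_{i,j}])$. The kernel $k$ is completely bounded if for every finite $F\subset X$ this entrywise map is completely bounded (no bound uniform in $F$ is required). An $(\mathcal{A},\mathcal{B})$-correspondence $E$ is a (right) Hilbert $C^*$-module over $\mathcal{B}$, with $\mathcal{B}$-valued inner product $\langle\cdot,\cdot\rangle$ linear in the second argument, together with a left action of $\mathcal{A}$ given by a unital $*$-homomorphism $\mathcal{A}\to\mathcal{L}^a(E)$, where $\mathcal{L}^a(E)$ is the $C^*$-algebra of adjointable operators on $E$. A kernel $k$ has a Kolmogorov decomposition if there is a triple $(E,\iota,J)$ with $E$ an $(\mathcal{A},\mathcal{B})$-correspondence, $\iota:X\to E$ a map, and $J\in\mathcal{L}^a(E)$ a contractive $\mathcal{A}$-module map (i.e. $J(a\cdot e)=a\cdot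 J(e)$), such that $k(x,y)[a]=\langle J\iota(x), a\cdot\iota(y)\rangle$ for all $x,y\in X$ and $a\in\mathcal{A}$. *)

(* Defs.v *)
From HB Require Import structures.
From mathcomp Require Import all_boot all_order all_algebra.
From mathcomp Require Import all_classical all_reals all_analysis.
From mathcomp Require Import complex.

Set Implicit Arguments.
Unset Strict Implicit.
Unset Printing Implicit Defensive.

Import Order.TTheory GRing.Theory Num.Theory.
Import numFieldNormedType.Exports.

Local Open Scope classical_set_scope.
Local Open Scope ring_scope.
Local Open Scope complex_scope.

(* Unital C*-algebras, the zero algebra included.  The ring operations are
   fields of the mixin because the hierarchy has no join of normed modules and
   rings; the [PzRing] instance below gives them the usual notations. *)
HB.mixin Record isCstarAlgebra (R : realType) A
    of CompleteNormedModule R[i] A := {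
  cstar_one : A;
  cstar_mul : A -> A -> A;
  star : A -> A;
  cstar_mulA : associative cstar_mul;
  cstar_mul1l : left_id cstar_one cstar_mul;
  cstar_mul1r : right_id cstar_one cstar_mul;
  cstar_mulDl : left_distributive cstar_mul +%R;
  cstar_mulDr : right_distributive cstar_mul +%R;
  cstar_scaleAl : forall (z : R[i]) (a b : A),
    z *: cstar_mul a b = cstar_mul (z *: a) b;
  cstar_scaleAr : forall (z : R[i]) (a b : A),
    z *: cstar_mul a b = cstar_mul a (z *: b);
  starD : forall a b : A, star (a + b) = star a + star b;
  starZ : forall (z : R[i]) (a : A), star (z *: a) = z^* *: star a;
  starM : forall a b : A, star (cstar_mul a b) = cstar_mul (star b) (star a);
  starK : forall a : A, star (star a) = a;
  cstar_normM : forall a b : A, `|cstar_mul a b| <= `|a| * `|b|;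
  cstar_norm : forall a : A, `|cstar_mul (star a) a| = `|a| ^+ 2
}.

#[short(type="cstarAlgType")]
HB.structure Definition CstarAlgebra (R : realType) :=
  {A of CompleteNormedModule R[i] A & isCstarAlgebra R A}.

HB.instance Definition _ (R : realType) (A : cstarAlgType R) :=
  GRing.Zmodule_isPzRing.Build (CstarAlgebra.sort A)
    (@cstar_mulA R A) (@cstar_mul1l R A) (@cstar_mul1r R A)
    (@cstar_mulDl R A) (@cstar_mulDr R A).

Definition cstar_ge0 (R : realType) (A : cstarAlgType R) (a : A) : Prop :=
  exists b : A, a = star b * b.

(* L(A, B) *)
Record boundedLinear (R : realType) (A B : cstarAlgType R) := BoundedLinear {
  bounded_fun :> {linear A -> B};
  bounded_funP : exists M : R[i], forall a : A, `|bounded_fun a| <= M * `|a|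
}.

Section MatrixAlgebra.
Variables (R : realType) (A : cstarAlgType R).

Definition mxstar m n (a : 'M[A]_(m, n)) : 'M[A]_(n, m) := (map_mx star a)^T.

(* Norms of normed modules over R[i] take values in R[i]; they are real. *)
Definition rnorm (a : A) : R := complex.Re `|a|.

(* The norm sqrt(|<v, v>|) of the standard Hilbert A-module A^n, where
   <v, w> = sum_i (v_i)^* w_i. *)
Definition cvnorm n (v : 'cV[A]_n) : R :=
  Num.sqrt (rnorm ((mxstar v *m v) ord0 ord0)).

(* The C*-norm of M_n(A): the operator norm for the (faithful) action of
   M_n(A) on the Hilbert A-module A^n, i.e. M_n(A) = L^a(A^n). *)
Definition mxnorm n (a : 'M[A]_n) : R :=
  sup [set cvnorm (a *m v) | v in [set v : 'cV[A]_n | cvnorm v <= 1]].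

Definition mx_ge0 n (p : 'M[A]_n) : Prop :=
  exists q : 'M[A]_n, p = mxstar q *m q.

End MatrixAlgebra.

(* The C*-algebra M_m(M_n(A)) is identified with M_{mn}(A) by erasing the
   block structure. *)
Definition completely_bounded (R : realType) (A B : cstarAlgType R) n
    (phi : 'M[A]_n -> 'M[B]_n) : Prop :=
  exists C : R, forall m (a : 'I_m -> 'I_m -> 'M[A]_n),
    mxnorm (\mxblock_(i < m, j < m) phi (a i j))
      <= C * mxnorm (\mxblock_(i < m, j < m) a i j).

Definition kernel_mx (R : realType) (A B : cstarAlgType R) (X : Type)
    (k : X -> X -> boundedLinear A B) n (x : 'I_n -> X)
    (a : 'M[A]_n) : 'M[B]_n :=
  \matrix_(i, j) k (x i) (x j) (a i j).

Definition completely_bounded_kernel (R : realType) (A B : cstarAlgType R)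
    (X : Type) (k : X -> X -> boundedLinear A B) : Prop :=
  forall n (x : 'I_n -> X), injective x -> completely_bounded (kernel_mx k x).

(* Injectivity (Arveson, Choi-Effros): completely positive maps into B defined
   on an operator system S of a unital C*-algebra N extend to completely
   positive maps on N.  A map on S is given by a function on N of which only
   the restriction to S matters. *)
Definition operator_system (R : realType) (N : cstarAlgType R)
    (S : set N) : Prop :=
  [/\ S 1,
      forall (z : R[i]) a b, S a -> S b -> S (z *: a + b) &
      forall a, S a -> S (star a)].

Definition linear_on (R : realType) (N B : cstarAlgType R) (S : set N)
    (phi : N -> B) : Prop :=
  forall (z : R[i]) a b, S a -> S b -> phi (z *: a + b) = z *: phi a + phi b.

Definition completely_positive_on (R : realType) (N B : cstarAlgType R)
    (S : set N) (phi : N -> B) : Prop :=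
  forall n (p : 'M[N]_n), (forall i j, S (p i j)) -> mx_ge0 p ->
    mx_ge0 (map_mx phi p).

Definition injective_cstar (R : realType) (B : cstarAlgType R) : Prop :=
  forall (N : cstarAlgType R) (S : set N) (phi : N -> B),
    operator_system S -> linear_on S phi -> completely_positive_on S phi ->
    exists psi : {linear N -> B},
      completely_positive_on setT psi /\ (forall a, S a -> psi a = phi a).

(* Right Hilbert C*-modules over B. *)
HB.mixin Record isHilbertModule (R : realType) (B : cstarAlgType R) E
    of CompleteNormedModule R[i] E := {
  ract : E -> B -> E;
  ractDl : forall (x y : E) (b : B), ract (x + y) b = ract x b + ract y b;
  ractDr : forall (x : E) (b c : B), ract x (b + c) = ract x b + ract x c;
  ractZl : forall (z : R[i]) (x : E) (b : B),
    ract (z *: x) b = z *: ract x b;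
  ractZr : forall (z : R[i]) (x : E) (b : B),
    ract x (z *: b) = z *: ract x b;
  ractM : forall (x : E) (b c : B), ract x (b * c) = ract (ract x b) c;
  ract1 : forall x : E, ract x 1 = x;
  inner : E -> E -> B;
  innerDr : forall x y z : E, inner x (y + z) = inner x y + inner x z;
  innerZr : forall (a : R[i]) (x y : E), inner x (a *: y) = a *: inner x y;
  inner_ract : forall (x y : E) (b : B), inner x (ract y b) = inner x y * b;
  inner_star : forall x y : E, star (inner x y) = inner y x;
  inner_ge0 : forall x : E, cstar_ge0 (inner x x);
  hnorm_inner : forall x : E, `|x| ^+ 2 = `|inner x x|
}.

#[short(type="hilbertModType")]
HB.structure Definition HilbertModule (R : realType) (B : cstarAlgType R) :=
  {E of CompleteNormedModule R[i] E & isHilbertModule R B E}.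

(* Linearity and boundedness are consequences. *)
Definition adjointable (R : realType) (B : cstarAlgType R)
    (E : hilbertModType B) (T : E -> E) : Prop :=
  exists T' : E -> E, forall x y : E, inner (T x) y = inner x (T' y).

(* [lact] is a unital *-homomorphism from A to the adjointable operators on E;
   [lact_star] expresses both that [lact a] is adjointable and that its adjoint
   is [lact (star a)]. *)
HB.mixin Record isCorrespondence (R : realType) (A B : cstarAlgType R) E
    of HilbertModule R B E := {
  lact : A -> E -> E;
  lactD : forall (a b : A) (x : E), lact (a + b) x = lact a x + lact b x;
  lactZ : forall (z : R[i]) (a : A) (x : E), lact (z *: a) x = z *: lact a x;
  lactM : forall (a b : A) (x : E), lact (a * b) x = lact a (lact b x);
  lact1 : forall x : E, lact 1 x = x;
  lact_star : forall (a : A) (x y : E),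
    inner (lact a x) y = inner x (lact (star a) y)
}.

#[short(type="correspondence")]
HB.structure Definition Correspondence (R : realType) (A B : cstarAlgType R) :=
  {E of HilbertModule R B E & isCorrespondence R A B E}.

Definition has_Kolmogorov_decomposition (R : realType) (A B : cstarAlgType R)
    (X : Type) (k : X -> X -> boundedLinear A B) : Prop :=
  exists (E : correspondence A B) (iota : X -> E) (J : E -> E),
    [/\ adjointable J,
        forall e : E, `|J e| <= `|e|,
        forall (a : A) (e : E), J (lact a e) = lact a (J e) &
        forall (x y : X) (a : A), k x y a = inner (J (iota x)) (lact a (iota y))].

(* Main.v *)
From HB Require Import structures.
From mathcomp Require Import all_boot all_order all_algebra.
From mathcomp Require Import all_classical all_reals all_analysis.
From mathcomp Require Import complex.
From mathcomp Require Import ssrAC ring lra.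
Require Import Defs.

(** Why every completely bounded kernel decomposes.

    Only the single maps [k x y] are used: an entry of a completely bounded
    matrix of maps is completely bounded ([completely_bounded_kernel_entry]).

    Consider first one completely contractive map [phi] from [A] to [B].  On the
    matrices of size 2 over [A] with scalar diagonal entries [l], [m] and with
    off-diagonal entries [a] and [star b], the map with value
    [l + phi a + star (phi b) + m] is completely positive.  Indeed a positive
    matrix of this kind has scalar diagonal blocks; after a small perturbation
    these can be made equal to 1 by congruence, which turns the corner into a
    contraction, [phi] keeps it a contraction, and a contractive corner makes the
    sum positive ([corner_positive]).  As [B] is injective, the map extends to a
    completely positive map [psi] on all matrices of size 2, and [phi a] is [psi]
    of the matrix with the single entry [a] in the upper right corner
    ([off_diagonal_extension]).

    The Gelfand-Naimark-Segal construction for [psi] yields a Hilbert module over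
    [B] spanned by vectors [v_S], where [S] is a matrix of size 2 over [A], with
    [psi (star S * T)] as the inner product of [v_S] and [v_T].  Write [e_ij] for
    the matrix units and let [J] be the action of [e_21].  It is a contraction, it
    commutes with the diagonal action of [A], and [phi a] is the inner product of
    [J v_(e_11)] with [a v_(e_22)].  Moreover [J v_(e_11)] is orthogonal to
    [a v_(e_11)], and [J v_(e_22)] vanishes.

    Now choose such a [psi] for every pair [(x, y)] and take the direct sum of
    the modules.  Let [iota x] have the component [t v_(e_11)] in the summands of
    the pairs [(x, y)] and [t^-1 v_(e_22)] in those of the pairs [(y, x)], up to a
    constant, where [t] depends on the pair.  By the relations above, only the
    summand of [(x, y)] contributes to the inner product of [J (iota x)] with
    [a (iota y)], and it contributes [k x y a] ([kolmogorov_decomposition]).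
    These components must be summable.  This is where countability enters: if
    [t] is chosen small for the pairs whose first point comes first in an
    enumeration of [X] and large for the others, then all but finitely many
    components of each [iota x] are as small as desired ([sq_mass_bound]).

    The remaining parts provide the tools.  Positive elements of a C*-algebra are
    treated without spectral theory, by square roots obtained from an iteration
    and by norm inequalities ([sqrt_one_sub], [cpos_star_mul]).  Matrices over a
    C*-algebra form a C*-algebra ([mxalg]).  The direct sum of modules is realized
    as a space of functions with a reproducing kernel ([hker]). *)

Set Implicit Arguments.
Unset Strict Implicit.
Unset Printing Implicit Defensive.
Import Order.TTheory GRing.Theory Num.Theory.
Import numFieldNormedType.Exports.
Local Open Scope classical_set_scope.
Local Open Scope ring_scope.
Local Open Scope complex_scope.

(** * Real-valued norms and convergence *)

Section RealNorm.
Variables (R : realType) (V : normedModType R[i]).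
Implicit Types x y z : V.

(** The norm of a module over [R[i]] takes values in [R[i]], although it is real.
    All estimates are made with this real-valued version. *)
Definition rn x : R := complex.Re `|x|.

Lemma rnE x : `|x| = (rn x)%:C.
Proof. by rewrite /rn RRe_real// normr_real. Qed.

Lemma rn_ge0 x : 0 <= rn x.
Proof. by rewrite -lecR -rnE normr_ge0. Qed.

Lemma rnD x y : rn (x + y) <= rn x + rn y.
Proof. by rewrite -lecR rmorphD/= -!rnE ler_normD. Qed.

Lemma rn0 : rn 0 = 0.
Proof. by rewrite /rn normr0. Qed.

Lemma rnN x : rn (- x) = rn x.
Proof. by rewrite /rn normrN. Qed.

Lemma rnBC x y : rn (x - y) = rn (y - x).
Proof. by rewrite -rnN opprB. Qed.

Lemma rn_triangle z x y : rn (x - y) <= rn (x - z) + rn (z - y).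
Proof. by rewrite -(subrKA z x (- y)) rnD. Qed.

Lemma rnZ (c : R[i]) x : rn (c *: x) = complex.Re `|c| * rn x.
Proof.
by rewrite {1}/rn normrZ rnE normc_def -rmorphM.
Qed.

Lemma rnZr (t : R) x : rn (t%:C *: x) = `|t| * rn x.
Proof. by rewrite rnZ normc_def/= expr0n/= addr0 sqrtr_sqr. Qed.

Lemma rnZp (t : R) x : 0 <= t -> rn (t%:C *: x) = t * rn x.
Proof. by move=> t0; rewrite rnZr ger0_norm. Qed.

Lemma rn_eq0 x : rn x = 0 -> x = 0.
Proof. by move=> x0; apply/eqP; rewrite -normr_eq0 rnE x0. Qed.

Lemma rn_sum (I : Type) (r : seq I) (P : pred I) (F : I -> V) :
  rn (\sum_(i <- r | P i) F i) <= \sum_(i <- r | P i) rn (F i).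
Proof.
elim/big_ind2 : _ => [|x1 x2 y1 y2 h1 h2|//]; first by rewrite rn0.
by rewrite (le_trans (rnD _ _))// lerD.
Qed.

Definition rcvg (u : nat -> V) (l : V) :=
  forall e : R, 0 < e -> exists N, forall n, (N <= n)%N -> rn (u n - l) <= e.

Definition rcauchy (u : nat -> V) :=
  forall e : R, 0 < e ->
    exists N, forall m n, (N <= m)%N -> (N <= n)%N -> rn (u m - u n) <= e.

Lemma rcvg_cst l : rcvg (fun=> l) l.
Proof. by move=> e e0; exists 0%N => n _; rewrite subrr rn0 ltW. Qed.

Lemma rcvg_near u v l : (exists N, forall n, (N <= n)%N -> u n = v n) ->
  rcvg u l -> rcvg v l.
Proof.
move=> [N uv] ul e /ul[M uM]; exists (maxn N M) => n; rewrite geq_max.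
by move=> /andP[Nn Mn]; rewrite -uv// uM.
Qed.

Lemma rcvg_shift u l : rcvg u l -> rcvg (fun n => u n.+1) l.
Proof. by move=> ul e /ul[N uN]; exists N => n Nn; rewrite uN// leqW. Qed.

Lemma rcvg_uniq u l l' : rcvg u l -> rcvg u l' -> l = l'.
Proof.
move=> ul ul'; apply/eqP; rewrite -subr_eq0; apply/eqP/rn_eq0/eqP.
rewrite eq_le rn_ge0 andbT; apply/ler_addgt0Pr => e e0.
have e20 : 0 < e / 2 by rewrite divr_gt0.
have [N uN] := ul _ e20; have [M uM] := ul' _ e20.
rewrite add0r (le_trans (rn_triangle (u (maxn N M)) _ _))// (splitr e).
by rewrite lerD// ?uM ?leq_maxr// rnBC uN// leq_maxl.
Qed.

Lemma rcvg_le u l c : (forall n, rn (u n) <= c) -> rcvg u l -> rn l <= c.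
Proof.
move=> uc ul; apply/ler_addgt0Pr => e /ul[N /(_ N (leqnn N))] uN.
by rewrite -(subrK (u N) l) (le_trans (rnD _ _))// addrC lerD// rnBC.
Qed.

End RealNorm.

Section Domination.
Variables (R : realType) (U V W : normedModType R[i]).

(** Every limit computed below rests on an estimate by one or two null sequences;
    the constants may be negative, so that no side condition is left. *)
Lemma rcvg_dom (u : nat -> U) (v : nat -> V) (w : nat -> W) l m k (c d : R) :
  (exists N, forall n, (N <= n)%N ->
     rn (u n - l) <= c * rn (v n - m) + d * rn (w n - k)) ->
  rcvg v m -> rcvg w k -> rcvg u l.
Proof.
move=> [N0 h] vm wk e e0.
pose D := 2 * (`|c| + `|d| + 1).
have D0 : 0 < D by rewrite /D; have := normr_ge0 c; have := normr_ge0 d; lra.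
have eD0 : 0 < e / D by rewrite divr_gt0.
have [N1 h1] := vm _ eD0; have [N2 h2] := wk _ eD0.
exists (maxn N0 (maxn N1 N2)) => n; rewrite !geq_max => /and3P[a0 a1 a2].
apply: (le_trans (h _ a0)); move: (h1 _ a1) (h2 _ a2) => {}h1 {}h2.
have -> : e = D * (e / D) by rewrite mulrC divfK// gt_eqF.
move: (e / D) eD0 h1 h2 => f f0 h1 h2.
have i1 : c * rn (v n - m) <= `|c| * f.
  apply: (@le_trans _ _ (`|c| * rn (v n - m))).
    by rewrite ler_wpM2r ?rn_ge0 ?ler_norm.
  by rewrite ler_wpM2l.
have i2 : d * rn (w n - k) <= `|d| * f.
  apply: (@le_trans _ _ (`|d| * rn (w n - k))).
    by rewrite ler_wpM2r ?rn_ge0 ?ler_norm.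
  by rewrite ler_wpM2l.
have := mulr_ge0 (normr_ge0 c) (ltW f0); have := mulr_ge0 (normr_ge0 d) (ltW f0).
by rewrite /D; lra.
Qed.

End Domination.

Section RcvgOps.
Variables (R : realType) (V : normedModType R[i]).
Implicit Types (u v : nat -> V) (l m : V).

Lemma rcvgD u v l m : rcvg u l -> rcvg v m -> rcvg (fun n => u n + v n) (l + m).
Proof.
apply: (@rcvg_dom _ _ _ _ _ _ _ _ _ _ 1 1); exists 0%N => n _.
by rewrite !mul1r opprD addrACA rnD.
Qed.

Lemma rcvgZ (z : R[i]) u l : rcvg u l -> rcvg (fun n => z *: u n) (z *: l).
Proof.
move=> ul; apply: (rcvg_dom (c := complex.Re `|z|) (d := 0)) (ul) (ul).
by exists 0%N => n _; rewrite mul0r addr0 -scalerBr rnZ.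
Qed.

Lemma rcvgN u l : rcvg u l -> rcvg (fun n => - u n) (- l).
Proof.
move=> ul; apply: (rcvg_dom (c := 1) (d := 0)) (ul) (ul).
by exists 0%N => n _; rewrite mul0r addr0 mul1r -opprD rnN.
Qed.

Lemma rcvgB u v l m : rcvg u l -> rcvg v m -> rcvg (fun n => u n - v n) (l - m).
Proof. by move=> ul /rcvgN; exact: rcvgD. Qed.

Lemma invn_small (e : R) : 0 < e ->
  exists N, forall n, (N <= n)%N -> n.+1%:R^-1 <= e.
Proof.
move=> e0; have [N hN] : exists N : nat, e^-1 <= N%:R.
  by exists (Num.truncn e^-1).+1; rewrite ltW// truncnS_gt.
exists N => n Nn; rewrite -[e]invrK lef_pV2 ?posrE ?invr_gt0 ?ltr0Sn//.
by rewrite (le_trans hN)// ler_nat leqW.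
Qed.

(** The centres of balls of radius [1 / (n + 1)] that belong to a Cauchy filter
    form a Cauchy sequence, because any two of these balls meet, and the filter
    converges to its limit. *)
Lemma complete_of_rcauchy :
  (forall u : nat -> V, rcauchy u -> exists l, rcvg u l) ->
  forall F : set_system V, ProperFilter F -> cauchy F -> cvg F.
Proof.
move=> H F PF /cauchyP cF.
have inv0 (n : nat) : 0 < (n.+1%:R^-1 : R)%:C by rewrite ltcR invr_gt0 ltr0Sn.
have /choice[x hx] : forall n : nat, exists x : V, F (ball x (n.+1%:R^-1 : R)%:C).
  by move=> n; apply: cF.
have xx (m n : nat) : rn (x m - x n) <= m.+1%:R^-1 + n.+1%:R^-1.
  have [z []] := filter_ex (filterI (hx m) (hx n)).
  rewrite -!ball_normE /ball_/= => zm zn.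
  rewrite (le_trans (rn_triangle z _ _))// lerD//.
    by rewrite -lecR -rnE ltW.
  by rewrite rnBC -lecR -rnE ltW.
have [] := H x.
  move=> e e0; have e20 : 0 < e / 2 by rewrite divr_gt0.
  have [N hN] := invn_small e20.
  by exists N => m n Nm Nn; rewrite (le_trans (xx m n))// (splitr e) lerD ?hN.
move=> l xl; apply/cvg_ex; exists l; apply/cvgrPdist_le => e e0.
have [e' ee'] : exists e' : R, e = e'%:C by apply/complex_realP; rewrite gtr0_real.
move: e0; rewrite ee' ltcR => e0.
have e20 : 0 < e' / 2 by rewrite divr_gt0.
have [N hN] := invn_small e20; have [M hM] := xl _ e20.
pose n := maxn N M; apply: filterS (hx n) => z; rewrite -ball_normE /ball_/= => zn.
rewrite rnE lecR (le_trans (rn_triangle (x n) _ _))// (splitr e') lerD//.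
  by rewrite rnBC hM// leq_maxr.
rewrite (@le_trans _ _ (n.+1%:R^-1))//; first by rewrite -lecR -rnE ltW.
by rewrite hN// leq_maxl.
Qed.

End RcvgOps.

Lemma rcauchy_cvg (R : realType) (V : completeNormedModType R[i]) (u : nat -> V) :
  rcauchy u -> exists l, rcvg u l.
Proof.
move=> cu.
have /cauchy_cvg/cvg_ex[l ul] : cauchy (u @ \oo).
  apply/cauchyP => e e0.
  have [e' ee'] : exists e' : R, e = e'%:C by apply/complex_realP; rewrite gtr0_real.
  move: e0; rewrite ee' ltcR => e0.
  have e20 : 0 < e' / 2 by rewrite divr_gt0.
  have [N hN] := cu _ e20; exists (u N); exists N => // n /= Nn.
  rewrite -ball_normE /ball_/= rnE ltcR (le_lt_trans (hN _ _ _ _))//.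
  by rewrite ltr_pdivrMr// mulr_natr mulr2n ltrDl.
exists l => e e0; move/cvgrPdist_le : ul => /(_ (e%:C)).
rewrite ltcR => /(_ e0)[N _ hN]; exists N => n Nn.
by rewrite rnBC -lecR -rnE hN.
Qed.

(** * Square roots in a C*-algebra *)

Section CstarBasics.
Variables (R : realType) (A : cstarAlgType R).
Implicit Types a b c : A.

Lemma scAl (z : R[i]) a b : z *: (a * b) = (z *: a) * b.
Proof. exact: cstar_scaleAl. Qed.

Lemma scAr (z : R[i]) a b : z *: (a * b) = a * (z *: b).
Proof. exact: cstar_scaleAr. Qed.

Lemma star_mul a b : star (a * b) = star b * star a.
Proof. exact: starM. Qed.

Lemma star0 : star (0 : A) = 0.
Proof. by rewrite -[X in star X](scale0r (0 : A)) starZ rmorph0 scale0r. Qed.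

Lemma starN a : star (- a) = - star a.
Proof. by apply/eqP; rewrite -subr_eq0 opprK -starD addNr star0. Qed.

Lemma starB a b : star (a - b) = star a - star b.
Proof. by rewrite starD starN. Qed.

Lemma star1 : star (1 : A) = 1.
Proof. by rewrite -[LHS]mulr1 -[X in _ * X]starK -star_mul mulr1 starK. Qed.

Lemma starZr (t : R) a : star (t%:C *: a) = t%:C *: star a.
Proof. by rewrite starZ; congr (_ *: _); exact: conjc_real. Qed.

Lemma star_sum (I : Type) (r : seq I) (P : pred I) (F : I -> A) :
  star (\sum_(i <- r | P i) F i) = \sum_(i <- r | P i) star (F i).
Proof. exact: (big_morph _ starD star0). Qed.

Lemma rnM a b : rn (a * b) <= rn a * rn b.
Proof. by rewrite -lecR rmorphM/= -!rnE; exact: cstar_normM. Qed.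

Lemma rn_star_mul a : rn (star a * a) = rn a ^+ 2.
Proof. by apply: complexI; rewrite rmorphXn/= -!rnE; exact: cstar_norm. Qed.

Lemma rn_star a : rn (star a) = rn a.
Proof.
suff H b : rn b <= rn (star b) by apply: le_anti; rewrite H -{2}(starK a) H.
have [->|b0] := eqVneq (rn b) 0; first exact: rn_ge0.
have b_gt0 : 0 < rn b by rewrite lt_neqAle eq_sym b0 rn_ge0.
rewrite -(ler_pM2r b_gt0) -expr2 -rn_star_mul; exact: rnM.
Qed.

Lemma rn_mul_star a : rn (a * star a) = rn a ^+ 2.
Proof. by rewrite -{1}(starK a) rn_star_mul rn_star. Qed.

Lemma rn1 : rn (1 : A) <= 1.
Proof.
have := rn_star_mul (1 : A); rewrite star1 mulr1 => h.
rewrite leNgt; apply/negP => h1.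
by move: h h1; rewrite expr2; nra.
Qed.

Lemma rn_sa_sqr a : star a = a -> rn (a * a) = rn a ^+ 2.
Proof. by move=> sa; rewrite -{1}sa rn_star_mul. Qed.

Lemma rcvgM (u v : nat -> A) l m :
  rcvg u l -> rcvg v m -> rcvg (fun n => u n * v n) (l * m).
Proof.
move=> ul vm; apply: (rcvg_dom (c := rn m) (d := rn l + 1)) (ul) (vm).
have [N uN] := ul _ ltr01; exists N => n /uN un.
have -> : u n * v n - l * m = (u n - l) * m + u n * (v n - m).
  by rewrite mulrBl mulrBr [RHS]addrC subrKA.
rewrite (le_trans (rnD _ _))// lerD//; first by rewrite (le_trans (rnM _ _))// mulrC.
rewrite (le_trans (rnM _ _))// ler_wpM2r ?rn_ge0//.
by rewrite -(subrK l (u n)) (le_trans (rnD _ _))// addrC lerD2l.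
Qed.

Lemma rcvg_star (u : nat -> A) l : rcvg u l -> rcvg (fun n => star (u n)) (star l).
Proof.
move=> ul; apply: (rcvg_dom (c := 1) (d := 0)) (ul) (ul).
by exists 0%N => n _; rewrite mul0r addr0 mul1r -starB rn_star.
Qed.

Lemma rcvg_sa (u : nat -> A) l : (forall n, star (u n) = u n) -> rcvg u l ->
  star l = l.
Proof.
move=> su ul; apply: (rcvg_uniq (u := u)) => //.
by apply: rcvg_near (rcvg_star ul); exists 0%N.
Qed.

Lemma commZ (z : R[i]) a b : GRing.comm a b -> GRing.comm a (z *: b).
Proof. by rewrite /GRing.comm -scAr -scAl => ->. Qed.

Lemma rcvg_comm c (u : nat -> A) l :
  (forall n, GRing.comm c (u n)) -> rcvg u l -> GRing.comm c l.
Proof.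
move=> cu ul; apply: (rcvg_uniq (u := fun n => c * u n)).
  exact: rcvgM (rcvg_cst c) ul.
apply: rcvg_near (rcvgM ul (rcvg_cst c)); exists 0%N => n _.
by rewrite -cu.
Qed.

Lemma comm_subr_sqr a b : GRing.comm a b -> a * a - b * b = (a - b) * (a + b).
Proof. by move=> ab; rewrite mulrBl !mulrDr ab addrKA. Qed.

End CstarBasics.

Section SquareRoot.
Variables (R : realType) (A : cstarAlgType R).
Implicit Types x y h : A.

(** Visser's iteration for the equation [y = (x + y * y) / 2], which is solved by
    one minus a square root of [1 - x]. *)
Fixpoint visser x n : A :=
  if n is m.+1 then (2^-1)%:C *: (x + visser x m * visser x m) else 0.

Lemma visserS x n :
  visser x n.+1 = (2^-1)%:C *: (x + visser x n * visser x n).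
Proof. by []. Qed.

(** The same iteration in [R] at [x = 1].  It increases and is bounded by 1, and it
    dominates the norms of the iterates and of their increments when [rn x <= 1].
    Hence the iteration converges even if [rn x = 1], where a geometric estimate
    would fail. *)
Fixpoint visserR n : R :=
  if n is m.+1 then 2^-1 * (1 + visserR m * visserR m) else 0.

Lemma visserR_bounds n : 0 <= visserR n <= 1.
Proof.
elim: n => [|n /andP[h0 h1]] /=; first by rewrite lexx ler01.
by apply/andP; split; nra.
Qed.

Lemma visserR_incr n : visserR n <= visserR n.+1.
Proof.
rewrite /=; have /andP[_] := visserR_bounds n; move: (visserR n) => t t1.
have := sqr_ge0 (1 - t); rewrite expr2; nra.
Qed.

Lemma visserR_le m n : (m <= n)%N -> visserR m <= visserR n.
Proof.
move=> /subnK <-; elim: (n - m)%N => [//|k IH].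
by rewrite addSn (le_trans IH)// visserR_incr.
Qed.

Lemma visserR_cauchy (e : R) : 0 < e ->
  exists N, forall m n, (N <= m)%N -> (m <= n)%N -> visserR n - visserR m <= e.
Proof.
move=> e0; pose S := range visserR.
have hS : has_sup S.
  split; first by exists (visserR 0), 0%N.
  by exists 1 => _ [n _ <-]; have /andP[] := visserR_bounds n.
have [_ [N _ <-] hN] := sup_adherent e0 hS; exists N => m n Nm mn.
have : visserR n <= sup S by apply: sup_upper_bound => //; exists n.
by have := visserR_le Nm; lra.
Qed.

Lemma visser_comm x y n : GRing.comm y x -> GRing.comm y (visser x n).
Proof.
move=> yx; elim: n => [|n IH] /=; first exact: commr0.
by apply: commZ; apply: commrD => //; exact: commrM.
Qed.

Lemma visser_comm2 x m n : GRing.comm (visser x m) (visser x n).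
Proof. by apply: visser_comm; apply/commr_sym/visser_comm/commr_refl. Qed.

Lemma visser_sa x n : star x = x -> star (visser x n) = visser x n.
Proof.
move=> sx; elim: n => [|n IH] /=; first by rewrite star0.
by rewrite starZr starD sx star_mul IH.
Qed.

Lemma visser_norm x n : rn x <= 1 -> rn (visser x n) <= visserR n.
Proof.
move=> x1; elim: n => [|n IH] /=; first by rewrite rn0.
rewrite rnZp ?invr_ge0// ler_wpM2l ?invr_ge0// (le_trans (rnD _ _))// lerD//.
by rewrite (le_trans (rnM _ _))// ler_pM ?rn_ge0.
Qed.

Lemma visser_step x n : rn x <= 1 ->
  rn (visser x n.+1 - visser x n) <= visserR n.+1 - visserR n.
Proof.
move=> x1; elim: n => [|n IH].
  by rewrite /= !mulr0 !subr0 !addr0 rnZp ?invr_ge0// ler_wpM2l ?invr_ge0.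
set y := visser x n.+1 in IH *; set z := visser x n in IH *.
set t := visserR n.+1 in IH *; set s := visserR n in IH *.
have -> : visser x n.+2 - y = (2^-1)%:C *: ((y - z) * (y + z)).
  rewrite (visserS x n.+1) -/y [X in _ - X](visserS x n : y = _) -/z.
  rewrite -scalerBr opprD addrACA subrr add0r.
  by rewrite comm_subr_sqr//; exact: visser_comm2.
have -> : visserR n.+2 - t = 2^-1 * ((t - s) * (t + s)).
  rewrite (erefl : visserR n.+2 = 2^-1 * (1 + t * t)).
  rewrite [X in _ - X](erefl : t = 2^-1 * (1 + s * s)).
  by clear; move: t s => t s; lra.
rewrite rnZp ?invr_ge0// ler_wpM2l ?invr_ge0// (le_trans (rnM _ _))//.
rewrite ler_pM ?rn_ge0// (le_trans (rnD _ _))// lerD// ?visser_norm//.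
Qed.

Lemma visser_diff x m n : rn x <= 1 -> (m <= n)%N ->
  rn (visser x n - visser x m) <= visserR n - visserR m.
Proof.
move=> x1 /subnK <-; elim: (n - m)%N => [|k IH]; first by rewrite !subrr rn0.
rewrite addSn (le_trans (rn_triangle (visser x (k + m)) _ _))//.
by have := visser_step (k + m) x1; move: IH; lra.
Qed.

(** The last clause takes the place of the remark that a square root lies in the
    closed subalgebra generated by [x]: each iterate is a polynomial in [x], so
    the limit commutes with everything that commutes with [x]. *)
Lemma sqrt_one_sub x : star x = x -> rn x <= 1 ->
  exists y, [/\ star y = y, rn y <= 1, (1 - y) * (1 - y) = 1 - x &
    forall c, GRing.comm c x -> GRing.comm c y].
Proof.
move=> sx x1.
have [y ly] : exists y, rcvg (visser x) y.
  apply: rcauchy_cvg => e /visserR_cauchy[N hN]; exists N => m n Nm Nn.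
  wlog mn : m n Nm Nn / (m <= n)%N.
    by move=> H; case/orP: (leq_total m n) => /H; [|rewrite rnBC]; exact.
  by rewrite rnBC (le_trans (visser_diff x1 mn))// hN.
exists y; split.
- by apply: rcvg_sa ly => n; exact: visser_sa.
- apply: rcvg_le ly => n; rewrite (le_trans (visser_norm n x1))//.
  by have /andP[] := visserR_bounds n.
- have e : y = (2^-1)%:C *: (x + y * y).
    apply: rcvg_uniq (rcvg_shift ly) _.
    by apply/rcvgZ/rcvgD; [exact: rcvg_cst | exact: rcvgM].
  have {}e : x = y + y - y * y.
    apply/eqP; rewrite eq_sym subr_eq; apply/eqP.
    rewrite {1 2}e -scalerDl -rmorphD/=.
    by rewrite -[2^-1]mul1r -splitr scale1r.
  by rewrite e mulrBl mul1r mulrBr mulr1 !opprD opprK !addrA.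
- by move=> c cx; apply: rcvg_comm ly => n; exact: visser_comm.
Qed.

End SquareRoot.

(** * The positive cone *)

Section Positivity.
Variables (R : realType) (A : cstarAlgType R).
Implicit Types a b c f g h r s u : A.
Implicit Types t : R.

(** Positivity as a norm condition.  For self-adjoint [h] it says that the spectrum
    of [h] lies in [[0, 2t]], but it needs no spectrum, and it makes the cone
    closed under sums and limits at once.  The agreement with [cstar_ge0] is
    Kaplansky's theorem, [cpos_star_mul]. *)
Definition cpos h :=
  star h = h /\ exists2 t : R, 0 <= t & rn (t%:C *: (1 : A) - h) <= t.

Lemma rn_scalar t : 0 <= t -> rn (t%:C *: (1 : A)) <= t.
Proof. by move=> t0; rewrite rnZp// -[leRHS]mulr1 ler_wpM2l// rn1. Qed.

Lemma comm_scalar (z : R[i]) a : GRing.comm a (z *: (1 : A)).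
Proof. by apply/commZ/commr1. Qed.

Lemma scaleCM (s t : R) a : s%:C *: (t%:C *: a) = (s * t)%:C *: a.
Proof. by rewrite scalerA -rmorphM. Qed.

Lemma scale1C a : (1 : R)%:C *: a = a.
Proof. exact: scale1r. Qed.

Lemma half_double a : (2^-1)%:C *: (a + a) = a.
Proof.
by rewrite scalerDr -scalerDl -rmorphD/= -[2^-1]mul1r -splitr scale1r.
Qed.

(** The element [u = r + i s] satisfies [star u * u = t], and [r] is its real part,
    so [r] is no larger in norm than [u]. *)
Lemma comm_sqrD_bound r s t : star r = r -> star s = s -> GRing.comm r s ->
  0 <= t -> r * r + s * s = t%:C *: (1 : A) -> rn r ^+ 2 <= t.
Proof.
move=> sr ss rs t0 e; pose v := 'i%C *: s; pose u := r + v.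
have sv : star v = - v.
  rewrite /v starZ ss -scaleNr; congr (_ *: _); apply/eqP.
  by rewrite eq_complex /= oppr0 !eqxx.
have vv : v * v = - (s * s).
  by rewrite /v -scAl -scAr scalerA -expr2 sqr_i scaleN1r.
have uu : star u * u = t%:C *: (1 : A).
  rewrite /u starD sr sv -comm_subr_sqr ?vv ?opprK//.
  exact: commZ.
have ut : rn u ^+ 2 <= t by rewrite -rn_star_mul uu rn_scalar.
suff : rn r <= rn u by move=> h; rewrite (le_trans _ ut)// lerXn2r ?nnegrE ?rn_ge0.
have -> : r = (2^-1)%:C *: (star u + u).
  by rewrite /u starD sr sv addrACA addNr addr0 half_double.
rewrite rnZp ?invr_ge0//; have := rnD (star u) u; rewrite rn_star.
by lra.
Qed.

(** [1 - r * r] is the square of a self-adjoint [s] that commutes with [r], and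
    [comm_sqrD_bound] bounds [s].  This replaces the spectral mapping theorem for
    squares. *)
Lemma sqr_sub1_le r : star r = r -> rn r <= 1 -> rn (1 - r * r) <= 1.
Proof.
move=> sr r1; have [||y [sy y1 e cy]] := @sqrt_one_sub R A (r * r).
- by rewrite star_mul sr.
- by rewrite rn_sa_sqr// expr_le1 ?rn_ge0.
have ss : star (1 - y) = 1 - y by rewrite starB star1 sy.
rewrite -e rn_sa_sqr//; apply: (@comm_sqrD_bound _ r) => //.
  by apply/commr_sym/commrB; [exact: commr1|apply/cy/commrM].
by rewrite e subrK scale1C.
Qed.

Lemma sqr_sub_le r t : star r = r -> rn r ^+ 2 <= t ->
  rn (t%:C *: (1 : A) - r * r) <= t.
Proof.
move=> sr rt; have t0 : 0 <= t by rewrite (le_trans _ rt)// sqr_ge0.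
have [t00|t_neq0] := eqVneq t 0.
  move: rt; rewrite t00 -rn_sa_sqr// => rt.
  rewrite (@rn_eq0 _ _ (r * r)) ?subr0 ?rn_scalar//; apply/le_anti.
  by rewrite rt rn_ge0.
have t_gt0 : 0 < t by rewrite lt_neqAle eq_sym t_neq0.
have st0 : 0 < Num.sqrt t by rewrite sqrtr_gt0.
have := @sqr_sub1_le ((Num.sqrt t)^-1%:C *: r).
rewrite starZr sr rnZp ?invr_ge0 ?sqrtr_ge0// mulrC ler_pdivrMr// mul1r => /(_ erefl) H.
have : rn r <= Num.sqrt t by rewrite -(ger0_norm (rn_ge0 r)) -sqrtr_sqr ler_wsqrtr.
move=> /H; rewrite -scAl -scAr scaleCM -invfM -expr2 sqr_sqrtr// => H1.
have -> : t%:C *: (1 : A) - r * r = t%:C *: (1 - (t^-1)%:C *: (r * r)).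
  by rewrite scalerBr scaleCM divff// scale1C.
by rewrite rnZp// -[leRHS]mulr1 ler_wpM2l.
Qed.

Lemma cpos_sqr r : star r = r -> cpos (r * r).
Proof.
move=> sr; split; first by rewrite star_mul sr.
by exists (rn r ^+ 2); [exact: sqr_ge0 | exact: sqr_sub_le].
Qed.

Lemma cposZ t h : 0 <= t -> cpos h -> cpos (t%:C *: h).
Proof.
move=> t0 [sh [s s0 hs]]; split; first by rewrite starZr sh.
exists (t * s); first exact: mulr_ge0.
by rewrite -scaleCM -scalerBr rnZp// ler_wpM2l.
Qed.

Lemma cpos_sqrt h : cpos h -> exists r, [/\ star r = r, cpos r, r * r = h &
  forall c, GRing.comm c h -> GRing.comm c r].
Proof.
move=> [sh [t t0 ht]]; have [t00|t_neq0] := eqVneq t 0.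
  exists 0; split; rewrite ?star0 ?mulr0//; last by move=> c _; exact: commr0.
    by split; [exact: star0|exists 0; rewrite // scale0r subr0 rn0].
  move: ht; rewrite t00 scale0r sub0r rnN => h0.
  by rewrite (@rn_eq0 _ _ h)//; apply/le_anti; rewrite h0 rn_ge0.
have t_gt0 : 0 < t by rewrite lt_neqAle eq_sym t_neq0.
pose x := 1 - (t^-1)%:C *: h.
have ex : x = (t^-1)%:C *: (t%:C *: (1 : A) - h).
  by rewrite scalerBr scaleCM mulVf// scale1C.
have [||y [sy y1 e cy]] := @sqrt_one_sub R A x.
- by rewrite starB star1 starZr sh.
- by rewrite ex rnZp ?invr_ge0// mulrC ler_pdivrMr// mul1r.
exists ((Num.sqrt t)%:C *: (1 - y)); split.
- by rewrite starZr starB star1 sy.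
- apply: cposZ; first exact: sqrtr_ge0.
  split; first by rewrite starB star1 sy.
  by exists 1; rewrite ?ler01// scale1C opprB addrC subrK.
- rewrite -scAl -scAr scaleCM -expr2 sqr_sqrtr// e /x opprB addrC subrK.
  by rewrite scaleCM divff// scale1C.
- move=> c ch; apply: commZ; apply: commrB; first exact: commr1.
  by apply: cy; apply: commrB; [exact: commr1|exact: commZ].
Qed.

Lemma cpos_sa h : cpos h -> star h = h.
Proof. by case. Qed.

Lemma cpos_sub_le h t : cpos h -> rn h <= t -> rn (t%:C *: (1 : A) - h) <= t.
Proof.
move=> /cpos_sqrt[r [sr _ <- _]] rt; apply: sqr_sub_le => //.
by rewrite -rn_sa_sqr.
Qed.

Lemma cpos0 : cpos 0.
Proof. by have := @cpos_sqr 0; rewrite star0 mulr0; apply. Qed.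

Lemma cposD h g : cpos h -> cpos g -> cpos (h + g).
Proof.
move=> ph pg; split; first by rewrite starD !cpos_sa.
exists (rn h + rn g); first by rewrite addr_ge0 ?rn_ge0.
rewrite rmorphD/= scalerDl opprD addrACA (le_trans (rnD _ _))//.
by rewrite lerD// cpos_sub_le.
Qed.

Lemma cpos_sum (I : Type) (l : seq I) (P : pred I) (F : I -> A) :
  (forall i, P i -> cpos (F i)) -> cpos (\sum_(i <- l | P i) F i).
Proof. by move=> h; elim/big_ind : _ => //; [exact: cpos0|exact: cposD]. Qed.

Lemma cpos_lim (v : nat -> A) h : (forall n, cpos (v n)) -> rcvg v h -> cpos h.
Proof.
move=> pv vh; split; first by apply: rcvg_sa vh => n; exact: cpos_sa.
exists (rn h + 1); first by rewrite addr_ge0 ?rn_ge0 ?ler01.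
apply/ler_addgt0Pr => e e0.
have m0 : 0 < Num.min e 1 by rewrite lt_min e0 ltr01.
have [N /(_ N (leqnn N))] := vh _ m0; rewrite le_min => /andP[h1 h2].
rewrite (le_trans (rn_triangle (v N) _ _))// lerD// cpos_sub_le//.
by rewrite -(subrK h (v N)) (le_trans (rnD _ _))// addrC lerD2l.
Qed.

Lemma cpos_eps h : (forall e : R, 0 < e -> cpos (h + e%:C *: (1 : A))) -> cpos h.
Proof.
move=> H; apply: (@cpos_lim (fun n => h + (n.+1%:R^-1)%:C *: (1 : A))).
  by move=> n; apply: H; rewrite invr_gt0 ltr0Sn.
move=> e e0; have [N hN] := invn_small e0; exists N => n Nn.
by rewrite addrC addKr (le_trans (rn_scalar _)) ?invr_ge0// hN.
Qed.

Lemma cpos_scalar t : 0 <= t -> cpos (t%:C *: (1 : A)).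
Proof. by move=> t0; apply: cposZ => //; have := cpos_sqr (star1 A); rewrite mulr1. Qed.

(** Write [h = r * r] and [t - h = s * s] with commuting [r] and [s]; then
    [comm_sqrD_bound] applies. *)
Lemma cpos_le_rn h t : 0 <= t -> cpos h -> cpos (t%:C *: (1 : A) - h) -> rn h <= t.
Proof.
move=> t0 /cpos_sqrt[r [sr _ e _]] /cpos_sqrt[s [ss _ es cs]].
rewrite -e rn_sa_sqr//; apply: (@comm_sqrD_bound _ s) => //.
  apply: cs; apply: commrB; first exact: comm_scalar.
  by rewrite -e; exact: commrM.
by rewrite es e addrC subrK.
Qed.

Lemma cpos_rn_sub h : star h = h -> cpos ((rn h)%:C *: (1 : A) - h).
Proof.
move=> sh; split; first by rewrite starB starZr star1 sh.
by exists (rn h); rewrite ?rn_ge0// opprB addrC subrK.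
Qed.

Lemma cpos_le_sub h t : star h = h -> rn h <= t -> cpos (t%:C *: (1 : A) - h).
Proof.
move=> sh ht.
have -> : t%:C *: (1 : A) - h =
    ((rn h)%:C *: (1 : A) - h) + (t - rn h)%:C *: (1 : A).
  by rewrite addrAC -scalerDl -rmorphD/= [rn h + _]addrC subrK.
by apply: cposD; [exact: cpos_rn_sub | apply: cpos_scalar; rewrite subr_ge0].
Qed.

Lemma cpos_mono h g : cpos h -> cpos (g - h) -> rn h <= rn g.
Proof.
move=> ph pgh; apply: cpos_le_rn => //; first exact: rn_ge0.
have -> : (rn g)%:C *: (1 : A) - h = ((rn g)%:C *: (1 : A) - g) + (g - h).
  by rewrite subrKA.
apply: cposD => //; apply: cpos_rn_sub.
by rewrite -(subrK h g) starD !cpos_sa.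
Qed.

Lemma cpos_anti h : cpos h -> cpos (- h) -> h = 0.
Proof.
move=> ph nh; apply/rn_eq0/le_anti; rewrite rn_ge0 andbT.
by apply: cpos_le_rn => //; rewrite scale0r sub0r.
Qed.

Lemma rn_sa_exp2 h k : star h = h -> rn (h ^+ (2 ^ k)) = rn h ^+ (2 ^ k).
Proof.
move=> sh; have sX n : star (h ^+ n) = h ^+ n.
  by elim: n => [|n IH]; rewrite ?expr0 ?star1// exprS star_mul IH sh -exprSr -exprS.
elim: k => [|k IH]; first by rewrite !expr1.
by rewrite expnS mulnC !exprM expr2 rn_sa_sqr// IH expr2.
Qed.

(** If [p] were larger than 1, Bernoulli's inequality at [m = 2 ^ N] would make
    [p ^+ (2 * m)] grow at least quadratically in [m]. *)
Lemma exp_growth (p K : R) : 0 <= p -> (forall k, p ^+ (2 ^ k) <= 1 + (2 ^ k)%:R * K) ->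
  p <= 1.
Proof.
move=> p0 H; rewrite leNgt; apply/negP => p1.
pose d := p - 1; have d0 : 0 < d by rewrite subr_gt0.
have bern n : 1 + n%:R * d <= p ^+ n.
  elim: n => [|n IH]; first by rewrite mul0r addr0 expr0.
  rewrite exprS (le_trans _ (ler_wpM2l p0 IH))//.
  rewrite -[in leRHS](subrK 1 p) -/d -natr1.
  by have := ler0n R n; move: (n%:R : R) => x; nra.
have [N hN] : exists N : nat, 2 * K < N%:R * d ^+ 2.
  exists (Num.truncn (2 * K / d ^+ 2)).+1.
  by rewrite -ltr_pdivrMr ?exprn_gt0// truncnS_gt.
have Npow : (N <= 2 ^ N)%N by rewrite ltnW// ltn_expl.
(* the exponent [2 ^ N.+1] is twice [2 ^ N], so Bernoulli's bound is squared *)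
have := H N.+1; rewrite expnS mulnC exprM natrM.
set m := (2 ^ N)%N in Npow *; have := bern m.
have m0 : 0 < m%:R :> R by rewrite ltr0n expn_gt0.
have {hN} : 2 * K < m%:R * d ^+ 2.
  by rewrite (lt_le_trans hN)// ler_wpM2r ?sqr_ge0// ler_nat.
rewrite !expr2; move: (m%:R : R) (p ^+ m) m0 => x y x0 h1 h2 h3.
have xd : 0 < x * d by rewrite mulr_gt0.
have : (1 + x * d) * (1 + x * d) <= y * y by rewrite ler_pM//; lra.
have : x * (2 * K) < x * (x * (d * d)) by rewrite ltr_pM2l.
by nra.
Qed.

(** This stands in for the fact that [star c * c] and [c * star c] have the same
    nonzero spectrum.  With [P = t + c * star c] and [Q = t + star c * c] one has
    [star c * P = Q * star c], whence [P ^+ n = t ^+ n + c * q * star c] where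
    [q] is a sum of [n] products of powers of [t] and [Q].  So the norms of the
    powers of [P / t] grow at most linearly, while they are the powers of one
    norm when [n] is a power of 2. *)
Lemma star_mul_swap c t : 0 < t -> rn (t%:C *: (1 : A) + star c * c) <= t ->
  rn (t%:C *: (1 : A) + c * star c) <= t.
Proof.
move=> t0; set Q := _ + star c * c => Qt; set P := _ + c * star c.
have cP : star c * P = Q * star c.
  by rewrite mulrDr mulrDl mulrA -scAr -scAl mulr1 mul1r.
have sP : star P = P by rewrite starD starZr star1 star_mul starK.
have H n : exists2 q : A, rn q * t <= n%:R * t ^+ n &
    P ^+ n = (t ^+ n)%:C *: (1 : A) + c * q * star c.
  elim: n => [|n [q qn Pn]].
    by exists 0; rewrite ?rn0 ?mul0r// mulr0 mul0r addr0 scale1C.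
  exists ((t ^+ n)%:C *: (1 : A) + q * Q).
    rewrite (@le_trans _ _ ((t ^+ n + rn q * t) * t))//.
      rewrite ler_wpM2r ?(ltW t0)// (le_trans (rnD _ _))// lerD//.
        by rewrite rn_scalar// exprn_ge0// (ltW t0).
      by rewrite (le_trans (rnM _ _))// ler_wpM2l ?rn_ge0.
    by rewrite exprSr -natr1 mulrA ler_wpM2r ?(ltW t0)// mulrDl mul1r addrC lerD2r.
  rewrite exprSr Pn mulrDl -(mulrA _ (star c)) cP {1}/P -scAl mul1r scalerDr.
  rewrite scaleCM -exprSr -addrA; congr (_ + _).
  rewrite mulrDr mulrDl -scAr mulr1 -!scAl; congr (_ + _).
  by rewrite !mulrA.
pose p := rn P / t; have p0 : 0 <= p by rewrite divr_ge0 ?rn_ge0 ?ltW.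
suff : p <= 1 by rewrite ler_pdivrMr// mul1r.
apply: (@exp_growth p (rn c ^+ 2 / t)) => // k.
rewrite expr_div_n -rn_sa_exp2//.
move: (2 ^ k)%N => n; have [q qn ->] := H n.
have tn0 : 0 < t ^+ n by rewrite exprn_gt0.
rewrite ler_pdivrMr// (le_trans (rnD _ _))// mulrDl mul1r lerD//.
  by rewrite rn_scalar// ltW.
rewrite (@le_trans _ _ (rn c ^+ 2 * rn q))//.
  rewrite expr2 mulrAC (le_trans (rnM _ _))// rn_star ler_wpM2r ?rn_ge0//.
  exact: rnM.
have -> : n%:R * (rn c ^+ 2 / t) * t ^+ n = rn c ^+ 2 * (n%:R * t ^+ n / t).
  by field; rewrite gt_eqF.
by rewrite ler_wpM2l ?sqr_ge0// ler_pdivlMr.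
Qed.

Lemma cpos_star_mulD c : cpos (star c * c + c * star c).
Proof.
pose u := c + star c; pose v := 'i%C *: (c - star c).
have su : star u = u by rewrite starD starK addrC.
have sv : star v = v.
  rewrite /v starZ starB starK -[star c - c]opprB scalerN -scaleNr.
  by congr (_ *: _); apply/eqP; rewrite eq_complex /= opprK oppr0 !eqxx.
have -> : star c * c + c * star c = (2^-1)%:C *: (u * u + v * v).
  have -> : v * v = - ((c - star c) * (c - star c)).
    by rewrite /v -scAl -scAr scalerA -expr2 sqr_i scaleN1r.
  rewrite /u mulrBl mulrDl !mulrBr !mulrDr.
  set x := c * c; set y := c * star c; set z := star c * c; set w := star c * star c.
  have -> : x + y + (z + w) - (x - y - (z - w)) = (z + y) + (z + y).
    have -> : x - y - (z - w) = x + w - (y + z) by rewrite opprB addrACA opprD.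
    rewrite [z + w]addrC (addrACA x y w z) opprB [LHS]addrC subrKA.
    by rewrite [y + z]addrC.
  by rewrite half_double.
by apply: cposZ; [rewrite invr_ge0|apply: cposD; exact: cpos_sqr].
Qed.

Lemma cpos_swap_neg c : cpos (- (star c * c)) -> cpos (- (c * star c)).
Proof.
move=> pc; pose t := rn c ^+ 2 + 1.
have t0 : 0 < t by rewrite ltr_wpDl ?sqr_ge0.
split; first by rewrite starN star_mul starK.
exists t; first exact: ltW.
rewrite opprK star_mul_swap// -[star c * c]opprK cpos_sub_le//.
by rewrite rnN rn_star_mul lerDl.
Qed.

(** Kaplansky's theorem.  Let [h = star b * b], let [a] be the square root of
    [h * h], and let [f = a - h], which is twice the negative part of [h].  For
    [c = b * f] one finds [star c * c = - (f * a * f)], so that [star c * c] and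
    then [c * star c] are negative, although their sum is positive.  Hence
    [star c * c = 0], which forces [f = 0], that is [h = a]. *)
Theorem cpos_star_mul b : cpos (star b * b).
Proof.
set h := star b * b; have sh : star h = h by rewrite star_mul starK.
have [a [sa pa aa ca]] := cpos_sqrt (cpos_sqr sh).
have [g [sg _ gg cg]] := cpos_sqrt pa.
have ah : GRing.comm h a by apply: ca; exact: commrM.
pose f := a - h; have sf : star f = f by rewrite starB sa sh.
have fa : GRing.comm f a by apply/commr_sym/commrB; [exact: commr_refl|exact/commr_sym].
have fg : GRing.comm f g by exact: cg.
have hf : h * f = - (a * f).
  by rewrite /f !mulrBr aa opprB ah.
have sfg : star (f * g) = f * g by rewrite star_mul sf sg fg.
pose c := b * f.
have cc : star c * c = - (f * g * (f * g)).
  rewrite star_mul sf -mulrA (mulrA (star b)) -/h hf mulrN mulrA; congr (- _).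
  by rewrite -gg -!mulrA -fg.
have p1 : cpos (- (star c * c)) by rewrite cc opprK; exact: cpos_sqr.
have p2 : cpos (star c * c).
  rewrite -(addrK (c * star c) (star c * c)); apply: cposD; first exact: cpos_star_mulD.
  exact: cpos_swap_neg.
have c0 : star c * c = 0 by exact: cpos_anti.
have faf : f * (a * f) = 0.
  have : star c * c = - (f * (a * f)).
    by rewrite star_mul sf -mulrA (mulrA (star b)) -/h hf mulrN.
  by rewrite c0 => /esym/eqP; rewrite oppr_eq0 => /eqP.
have fff : f * (f * f) = 0.
  have -> : f * f = a * f - h * f by rewrite -mulrBl.
  by rewrite hf opprK mulrDr faf addr0.
have : rn (f * f) ^+ 2 = 0.
  by rewrite -rn_sa_sqr ?star_mul ?sf// -mulrA fff mulr0 rn0.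
rewrite rn_sa_sqr// => /eqP; rewrite !expf_eq0 /= => /eqP/rn_eq0/eqP.
by rewrite subr_eq0 => /eqP <-.
Qed.

Lemma cge0P h : cstar_ge0 h <-> cpos h.
Proof.
split=> [[b ->]|/cpos_sqrt[r [sr _ <- _]]]; first exact: cpos_star_mul.
by exists r; rewrite sr.
Qed.

Lemma cpos_conj b h : cpos h -> cpos (star b * h * b).
Proof.
move=> /cpos_sqrt[r [sr _ <- _]]; rewrite mulrA -mulrA -[X in _ * X * _]sr -star_mul.
exact: cpos_star_mul.
Qed.

End Positivity.

(** * The Cauchy-Schwarz inequality for Gram matrices *)

Section Gram.
Variables (R : realType) (A : cstarAlgType R).
Implicit Types b c x y z : A.

Lemma ler_add_mul (a b c : R) : 0 <= c ->
  (forall e, 0 < e -> a <= (b + e) * c) -> a <= b * c.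
Proof.
move=> c0 H; apply/ler_addgt0Pr => e e0.
have c1 : 0 < c + 1 by rewrite ltr_wpDl.
rewrite (le_trans (H (e / (c + 1)) _)) ?divr_gt0//.
rewrite mulrDl lerD2l mulrAC ler_pdivrMr// ler_wpM2l ?(ltW e0)//.
by rewrite lerDl.
Qed.

(** Here [x], [y], [z] play the roles of the inner products of [v] with [v], of [v]
    with [w] and of [w] with [w].  Stated for the Gram matrix alone, the
    inequality serves columns, formal sums and the completed module alike.  For
    [t] larger than [rn x], the hypothesis at [b = - y] and [c = t] gives
    [star y * y <= t * z] in the order of the algebra. *)
Lemma gram_cauchy_schwarz x y z :
  (forall b c, cpos (star b * x * b + star b * y * c +
                     star c * star y * b + star c * z * c)) ->
  rn y ^+ 2 <= rn x * rn z.
Proof.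
move=> H; apply: ler_add_mul; first exact: rn_ge0.
move=> e e0; pose t := rn x + e.
have t0 : 0 < t by rewrite ltr_wpDl ?rn_ge0.
have px : cpos x.
  by have := H 1 0; rewrite !(star1, star0, mul0r, mulr0, mul1r, mulr1, addr0).
have := H (- y) (t%:C *: (1 : A)); rewrite starN starZr star1.
rewrite !(mulNr, mulrN) opprK -!(scAl, scAr) !(mul1r, mulr1) scaleCM.
set q := star y * x * y; set p := star y * y => H1.
have H2 : cpos (t%:C *: p - q).
  have -> : t%:C *: p - q = star y * (t%:C *: (1 : A) - x) * y.
    by rewrite mulrBr mulrBl -scAr mulr1 -scAl.
  by apply/cpos_conj/cpos_le_sub; rewrite ?cpos_sa// lerDl ltW.
have {H1 H2} : cpos ((t * t)%:C *: z - t%:C *: p).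
  have -> : (t * t)%:C *: z - t%:C *: p =
      q - t%:C *: p - t%:C *: p + (t * t)%:C *: z + (t%:C *: p - q).
    rewrite [X in X + (_ - q)]addrAC -(addrA (q - _)) -(opprB q) [RHS]addrC.
    by rewrite addKr.
  exact: cposD.
move=> /(cposZ (ltW (_ : 0 < t^-1))); rewrite invr_gt0 => /(_ t0).
rewrite scalerBr !scaleCM mulrA mulVf ?gt_eqF// mul1r scale1C.
move=> /(cpos_mono (cpos_star_mul y)).
by rewrite rn_star_mul rnZp// ltW.
Qed.
End Gram.

(** * Matrices over a C*-algebra as operators on columns *)

Section MatrixStar.
Variables (R : realType) (A : cstarAlgType R).

Lemma mxstarE m n (a : 'M[A]_(m, n)) i j : mxstar a i j = star (a j i).
Proof. by rewrite /mxstar !mxE. Qed.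

Lemma mxstarK m n (a : 'M[A]_(m, n)) : mxstar (mxstar a) = a.
Proof. by apply/matrixP => i j; rewrite !mxstarE starK. Qed.

Lemma mxstarD m n (a b : 'M[A]_(m, n)) : mxstar (a + b) = mxstar a + mxstar b.
Proof. by apply/matrixP => i j; rewrite mxstarE !mxE starD. Qed.

Lemma mxstarM m n p (a : 'M[A]_(m, n)) (b : 'M[A]_(n, p)) :
  mxstar (a *m b) = mxstar b *m mxstar a.
Proof.
apply/matrixP => i j; rewrite mxstarE !mxE star_sum.
by apply: eq_bigr => k _; rewrite !mxE star_mul.
Qed.

End MatrixStar.

Section ColumnModule.
Variables (R : realType) (A : cstarAlgType R).

Definition ip n (v w : 'cV[A]_n) : A := (mxstar v *m w) ord0 ord0.

Definition cr n (v : 'cV[A]_n) (b : A) : 'cV[A]_n := \col_i (v i ord0 * b).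

Lemma ipE n (v w : 'cV[A]_n) : ip v w = \sum_i star (v i ord0) * w i ord0.
Proof. by rewrite /ip mxE; apply: eq_bigr => i _; rewrite mxstarE. Qed.

Lemma ip_star n (v w : 'cV[A]_n) : star (ip v w) = ip w v.
Proof. by rewrite /ip -mxstarE mxstarM mxstarK. Qed.

Lemma ipDr n (u v w : 'cV[A]_n) : ip u (v + w) = ip u v + ip u w.
Proof. by rewrite /ip mulmxDr mxE. Qed.

Lemma ipDl n (u v w : 'cV[A]_n) : ip (u + v) w = ip u w + ip v w.
Proof. by rewrite /ip mxstarD mulmxDl mxE. Qed.

Lemma ip0r n (v : 'cV[A]_n) : ip v 0 = 0.
Proof. by rewrite /ip mulmx0 mxE. Qed.

Lemma ip0l n (v : 'cV[A]_n) : ip 0 v = 0.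
Proof. by rewrite -ip_star ip0r star0. Qed.

Lemma ipNl n (v w : 'cV[A]_n) : ip (- v) w = - ip v w.
Proof. by apply/eqP; rewrite -addr_eq0 -ipDl addNr ip0l. Qed.

Lemma ipNr n (v w : 'cV[A]_n) : ip v (- w) = - ip v w.
Proof. by apply/eqP; rewrite -addr_eq0 -ipDr addNr ip0r. Qed.

Lemma ip_mulmx m n (v : 'cV[A]_m) (a : 'M[A]_(m, n)) (w : 'cV[A]_n) :
  ip v (a *m w) = ip (mxstar a *m v) w.
Proof. by rewrite /ip mxstarM mxstarK mulmxA. Qed.

Lemma ip_crr n (v w : 'cV[A]_n) b : ip v (cr w b) = ip v w * b.
Proof.
rewrite !ipE mulr_suml; apply: eq_bigr => i _.
by rewrite mxE mulrA.
Qed.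

Lemma ip_crl n (v w : 'cV[A]_n) b : ip (cr v b) w = star b * ip v w.
Proof. by rewrite -ip_star ip_crr star_mul ip_star. Qed.

Lemma ip_pos n (v : 'cV[A]_n) : cpos (ip v v).
Proof. by rewrite ipE; apply: cpos_sum => i _; exact: cpos_star_mul. Qed.

Lemma cvnormE n (v : 'cV[A]_n) : cvnorm v = Num.sqrt (rn (ip v v)).
Proof. by []. Qed.

Lemma cvnorm_ge0 n (v : 'cV[A]_n) : 0 <= cvnorm v.
Proof. exact: sqrtr_ge0. Qed.

Lemma cvnorm_sqr n (v : 'cV[A]_n) : cvnorm v ^+ 2 = rn (ip v v).
Proof. by rewrite cvnormE sqr_sqrtr ?rn_ge0. Qed.

Lemma ip_cauchy_schwarz n (v w : 'cV[A]_n) : rn (ip v w) <= cvnorm v * cvnorm w.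
Proof.
rewrite -(ler_pXn2r (_ : 0 < 2)%N) ?nnegrE ?rn_ge0 ?mulr_ge0 ?cvnorm_ge0//.
rewrite exprMn !cvnorm_sqr; apply: gram_cauchy_schwarz => b c.
have := ip_pos (cr v b + cr w c).
by rewrite ipDl !ipDr !ip_crr !ip_crl ip_star !addrA.
Qed.

Lemma cvnorm_le_sqr n (v : 'cV[A]_n) t : 0 <= t -> rn (ip v v) <= t ^+ 2 ->
  cvnorm v <= t.
Proof.
by move=> t0 h; rewrite -(ler_pXn2r (_ : 0 < 2)%N) ?nnegrE ?cvnorm_ge0// cvnorm_sqr.
Qed.

Lemma cvnormD n (v w : 'cV[A]_n) : cvnorm (v + w) <= cvnorm v + cvnorm w.
Proof.
apply: cvnorm_le_sqr; first by rewrite addr_ge0 ?cvnorm_ge0.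
rewrite ipDl !ipDr sqrrD !cvnorm_sqr mulr2n.
have := ip_cauchy_schwarz v w; have := ip_cauchy_schwarz w v.
have := rnD (ip v v + ip v w) (ip w v + ip w w).
by have := rnD (ip v v) (ip v w); have := rnD (ip w v) (ip w w); lra.
Qed.

Lemma cvnorm0 n : cvnorm (0 : 'cV[A]_n) = 0.
Proof. by rewrite cvnormE /ip mulmx0 mxE rn0 sqrtr0. Qed.

Lemma cvnorm_cr n (v : 'cV[A]_n) t : 0 <= t ->
  cvnorm (cr v (t%:C *: (1 : A))) = t * cvnorm v.
Proof.
move=> t0; rewrite !cvnormE ip_crr ip_crl starZr star1.
rewrite -scAr -!scAl mulr1 mul1r scaleCM rnZp ?mulr_ge0//.
by rewrite sqrtrM ?mulr_ge0// -expr2 sqrtr_sqr ger0_norm.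
Qed.

Lemma rn_entry_le n (v : 'cV[A]_n) i : rn (v i ord0) <= cvnorm v.
Proof.
rewrite -(ler_pXn2r (_ : 0 < 2)%N) ?nnegrE ?rn_ge0 ?cvnorm_ge0//.
rewrite -rn_star_mul cvnorm_sqr ipE; apply: cpos_mono; first exact: cpos_star_mul.
rewrite (bigD1 i)//= addrAC subrr add0r; apply: cpos_sum => j _; exact: cpos_star_mul.
Qed.

Lemma cvnorm_eq0 n (v : 'cV[A]_n) : cvnorm v = 0 -> v = 0.
Proof.
move=> v0; apply/colP => i; rewrite mxE; apply/rn_eq0/le_anti.
by rewrite rn_ge0 andbT -v0 rn_entry_le.
Qed.

Lemma cvnorm_le_sum n (v : 'cV[A]_n) : cvnorm v <= \sum_i rn (v i ord0).
Proof.
apply: cvnorm_le_sqr; first by apply: sumr_ge0 => i _; exact: rn_ge0.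
rewrite ipE (le_trans (rn_sum _ _ _))// expr2 big_distrl/=.
apply: ler_sum => i _; rewrite rn_star_mul expr2 ler_wpM2l ?rn_ge0//.
rewrite (bigD1 i)//= lerDl; apply: sumr_ge0 => j _; exact: rn_ge0.
Qed.

Lemma mulmx_cr n m (a : 'M[A]_(m, n)) (v : 'cV[A]_n) b :
  a *m cr v b = cr (a *m v) b.
Proof.
apply/colP => i; rewrite !mxE mulr_suml.
by apply: eq_bigr => j _; rewrite !mxE mulrA.
Qed.

Lemma cvnorm_mul_sum n (a : 'M[A]_n) (v : 'cV[A]_n) :
  cvnorm (a *m v) <= (\sum_i \sum_j rn (a i j)) * cvnorm v.
Proof.
rewrite (le_trans (cvnorm_le_sum _))// mulr_suml; apply: ler_sum => i _.
rewrite mxE (le_trans (rn_sum _ _ _))// mulr_suml; apply: ler_sum => j _.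
by rewrite (le_trans (rnM _ _))// ler_wpM2l ?rn_ge0// rn_entry_le.
Qed.

Lemma mxnorm_has_sup n (a : 'M[A]_n) :
  has_sup [set cvnorm (a *m v) | v in [set v : 'cV[A]_n | cvnorm v <= 1]].
Proof.
split; first by exists (cvnorm (a *m 0)), 0; rewrite //= cvnorm0.
exists (\sum_i \sum_j rn (a i j)) => _ [v /= v1 <-].
rewrite (le_trans (cvnorm_mul_sum _ _))// -[leRHS]mulr1 ler_wpM2l//.
by apply: sumr_ge0 => i _; apply: sumr_ge0 => j _; exact: rn_ge0.
Qed.

Lemma mxnorm_ge0 n (a : 'M[A]_n) : 0 <= mxnorm a.
Proof.
apply: le_trans (sup_upper_bound (mxnorm_has_sup a) _); last first.
  by exists 0; rewrite //= cvnorm0.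
exact: cvnorm_ge0.
Qed.

Lemma mxnormP n (a : 'M[A]_n) v : cvnorm (a *m v) <= mxnorm a * cvnorm v.
Proof.
have [v0|v0] := eqVneq (cvnorm v) 0.
  by rewrite v0 mulr0 (cvnorm_eq0 v0) mulmx0 cvnorm0.
have v_gt0 : 0 < cvnorm v by rewrite lt_neqAle eq_sym v0 cvnorm_ge0.
rewrite -ler_pdivrMr// mulrC -cvnorm_cr ?invr_ge0 ?cvnorm_ge0// -mulmx_cr.
apply: sup_upper_bound (mxnorm_has_sup a) _ _.
exists (cr v ((cvnorm v)^-1%:C *: (1 : A))) => //=.
by rewrite cvnorm_cr ?invr_ge0 ?cvnorm_ge0// mulVf.
Qed.

Lemma mxnorm_le n (a : 'M[A]_n) t : 0 <= t ->
  (forall v, cvnorm (a *m v) <= t * cvnorm v) -> mxnorm a <= t.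
Proof.
move=> t0 H; apply: ge_sup; first by case: (mxnorm_has_sup a).
move=> _ [v /= v1 <-]; rewrite (le_trans (H v))//.
by rewrite -[leRHS]mulr1 ler_wpM2l.
Qed.

Lemma mxnorm_le_sum n (a : 'M[A]_n) : mxnorm a <= \sum_i \sum_j rn (a i j).
Proof.
apply: mxnorm_le => [|v]; last exact: cvnorm_mul_sum.
by apply: sumr_ge0 => i _; apply: sumr_ge0 => j _; exact: rn_ge0.
Qed.

Lemma rn_entry_le_mxnorm n (a : 'M[A]_n) i j : rn (a i j) <= mxnorm a.
Proof.
pose e : 'cV[A]_n := \col_k (if k == j then 1 else 0).
have aij : a i j = (a *m e) i ord0.
  rewrite mxE (bigD1 j)//= mxE eqxx mulr1 big1 ?addr0// => k /negPf kj.
  by rewrite mxE kj mulr0.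
have e1 : cvnorm e <= 1.
  apply: cvnorm_le_sqr; rewrite ?ler01// ipE (bigD1 j)//= mxE eqxx star1 mul1r.
  rewrite big1 ?addr0 ?expr1n ?rn1// => k /negPf kj.
  by rewrite mxE kj mulr0.
rewrite aij (le_trans (rn_entry_le _ _))// (le_trans (mxnormP _ _))//.
by rewrite -[leRHS]mulr1 ler_wpM2l ?mxnorm_ge0.
Qed.

Lemma mxnormD n (a b : 'M[A]_n) : mxnorm (a + b) <= mxnorm a + mxnorm b.
Proof.
apply: mxnorm_le => [|v]; first by rewrite addr_ge0 ?mxnorm_ge0.
by rewrite mulmxDl (le_trans (cvnormD _ _))// mulrDl lerD// mxnormP.
Qed.

Lemma mxnormM n (a b : 'M[A]_n) : mxnorm (a *m b) <= mxnorm a * mxnorm b.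
Proof.
apply: mxnorm_le => [|v]; first by rewrite mulr_ge0 ?mxnorm_ge0.
rewrite -mulmxA (le_trans (mxnormP _ _))// -mulrA ler_wpM2l ?mxnorm_ge0//.
exact: mxnormP.
Qed.

(** The square of the norm of [a *m v] is the norm of the inner product of
    [mxstar a *m a *m v] with [v], to which Cauchy-Schwarz applies. *)
Lemma mxnorm_sqr_le n (a : 'M[A]_n) : mxnorm a ^+ 2 <= mxnorm (mxstar a *m a).
Proof.
set s := mxnorm (mxstar a *m a); have s0 : 0 <= s by exact: mxnorm_ge0.
rewrite -(sqr_sqrtr s0) lerXn2r ?nnegrE ?mxnorm_ge0 ?sqrtr_ge0//.
apply: mxnorm_le => [|v]; first exact: sqrtr_ge0.
apply: cvnorm_le_sqr; first by rewrite mulr_ge0 ?sqrtr_ge0 ?cvnorm_ge0.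
rewrite exprMn sqr_sqrtr// ip_mulmx mulmxA.
rewrite (le_trans (ip_cauchy_schwarz _ _))// expr2 mulrA.
by rewrite ler_wpM2r ?cvnorm_ge0// mxnormP.
Qed.

Lemma mxnorm_star n (a : 'M[A]_n) : mxnorm (mxstar a) = mxnorm a.
Proof.
suff H (b : 'M[A]_n) : mxnorm b <= mxnorm (mxstar b).
  by apply: le_anti; rewrite H -{2}(mxstarK a) H.
have [->|b0] := eqVneq (mxnorm (b : 'M[A]_n)) 0; first exact: mxnorm_ge0.
have b_gt0 : 0 < mxnorm b by rewrite lt_neqAle eq_sym b0 mxnorm_ge0.
rewrite -(ler_pM2r b_gt0) -expr2 (le_trans (mxnorm_sqr_le _))//.
exact: mxnormM.
Qed.

Lemma mxnorm_star_mul n (a : 'M[A]_n) : mxnorm (mxstar a *m a) = mxnorm a ^+ 2.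
Proof.
apply: le_anti; rewrite mxnorm_sqr_le andbT (le_trans (mxnormM _ _))//.
by rewrite mxnorm_star expr2.
Qed.

End ColumnModule.

(** * The C*-algebra of matrices over a C*-algebra *)

Lemma uniform_threshold (T : finType) (P : T -> nat -> Prop) :
  (forall t, exists N, forall n, (N <= n)%N -> P t n) ->
  exists N, forall n, (N <= n)%N -> forall t, P t n.
Proof.
move=> /choice[f hf]; exists (\max_t f t) => n Nn t; apply: hf.
exact: leq_trans (leq_bigmax t) Nn.
Qed.

(** A type of its own: matrices already form a module over [A], whereas here the
    scalars are complex and the norm is that of operators on columns. *)
Definition mxalg (R : realType) (A : cstarAlgType R) (n : nat) : Type := 'M[A]_n.

Section MatrixCstar.
Variables (R : realType) (A : cstarAlgType R) (n : nat).
Local Notation M := (mxalg A n).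

HB.instance Definition _ := GRing.Zmodule.copy M 'M[A]_n.

Definition mxscale (z : R[i]) (a : M) : M := map_mx ( *:%R z) a.

Lemma mxscaleA (y z : R[i]) (a : M) : mxscale y (mxscale z a) = mxscale (y * z) a.
Proof. by apply/matrixP => i j; rewrite !mxE scalerA. Qed.

Lemma mxscale1 : left_id 1 mxscale.
Proof. by move=> a; apply/matrixP => i j; rewrite !mxE scale1r. Qed.

Lemma mxscaleDr : right_distributive mxscale +%R.
Proof. by move=> z a b; apply/matrixP => i j; rewrite !mxE scalerDr. Qed.

Lemma mxscaleDl (a : M) : {morph mxscale^~ a : y z / y + z}.
Proof. by move=> y z; apply/matrixP => i j; rewrite !mxE scalerDl. Qed.

HB.instance Definition _ :=
  GRing.Zmodule_isLmodule.Build R[i] M mxscaleA mxscale1 mxscaleDr mxscaleDl.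

Definition mxnormC (a : M) : R[i] := (mxnorm (a : 'M[A]_n))%:C.

Lemma mxnormCD (a b : M) : mxnormC (a + b) <= mxnormC a + mxnormC b.
Proof. by rewrite /mxnormC -rmorphD lecR mxnormD. Qed.

(** Scaling is multiplication by a scalar matrix.  The reverse inequality follows
    by applying this one to the inverse scalar. *)
Lemma mxnormZ_le (z : R[i]) (a : M) :
  mxnorm (mxscale z a : 'M[A]_n) <= complex.Re `|z| * mxnorm (a : 'M[A]_n).
Proof.
have z0 : 0 <= complex.Re `|z| by rewrite -lecR RRe_real ?normr_real// normr_ge0.
have nz : `|z| = (complex.Re `|z|)%:C by rewrite RRe_real ?normr_real.
have -> : mxscale z a = (z *: (1 : A))%:M *m (a : 'M[A]_n).
  apply/matrixP => i j; rewrite mul_scalar_mx !mxE.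
  by rewrite -scAl mul1r.
rewrite (le_trans (mxnormM _ _))// ler_wpM2r ?mxnorm_ge0//.
apply: mxnorm_le => // v; apply: cvnorm_le_sqr.
  by rewrite mulr_ge0 ?cvnorm_ge0.
have -> : (z *: (1 : A))%:M *m v = \col_i (z *: v i ord0).
  by apply/colP => i; rewrite mul_scalar_mx !mxE -scAl mul1r.
rewrite exprMn cvnorm_sqr !ipE.
have -> : \sum_i star ((\col_i (z *: v i ord0)) i ord0) *
      (\col_i (z *: v i ord0)) i ord0 = ((complex.Re `|z|) ^+ 2)%:C *: ip v v.
  rewrite ipE scaler_sumr; apply: eq_bigr => i _.
  rewrite !mxE starZ -scAl -scAr scalerA; congr (_ *: _).
  transitivity (`|z| ^+ 2); first by rewrite sqr_normc mulrC.
  by rewrite {1}nz -rmorphXn.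
by rewrite -ipE rnZp ?sqr_ge0.
Qed.

Lemma mxnormCZ (z : R[i]) (a : M) : mxnormC (z *: a) = `|z| * mxnormC a.
Proof.
have nz : `|z| = (complex.Re `|z|)%:C by rewrite RRe_real ?normr_real.
rewrite nz /mxnormC -rmorphM; congr (_%:C); apply/le_anti.
rewrite mxnormZ_le andTb.
have [->|z0] := eqVneq z 0; first by rewrite normr0 mul0r mxnorm_ge0.
have r0 : 0 < complex.Re `|z| by rewrite -ltcR -nz normr_gt0.
rewrite mulrC -ler_pdivlMr// mulrC.
have {1}-> : a = mxscale z^-1 (mxscale z a) by rewrite mxscaleA mulVf// mxscale1.
rewrite (le_trans (mxnormZ_le _ _))// normfV nz -fmorphV/=.
exact: lexx.
Qed.

Lemma mxnormC_eq0 (a : M) : mxnormC a = 0 -> a = 0.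
Proof.
move=> /complexI a0; apply/matrixP => i j; rewrite mxE; apply/rn_eq0/le_anti.
by rewrite rn_ge0 andbT -a0 rn_entry_le_mxnorm.
Qed.

HB.instance Definition _ :=
  Lmodule_isNormed.Build R[i] M mxnormCD mxnormCZ mxnormC_eq0.

Lemma rn_mxalg (a : M) : rn a = mxnorm (a : 'M[A]_n).
Proof. by []. Qed.

Lemma mxalg_complete (F : set_system M) : ProperFilter F -> cauchy F -> cvg F.
Proof.
apply: complete_of_rcauchy => u cu.
have uB m k i j : rn ((u m : 'M[A]_n) i j - (u k : 'M[A]_n) i j) <= rn (u m - u k).
  rewrite rn_mxalg; have := rn_entry_le_mxnorm (u m - u k : 'M[A]_n) i j.
  by rewrite !mxE.
have H (ij : 'I_n * 'I_n) : exists l, rcvg (fun k => (u k : 'M[A]_n) ij.1 ij.2) l.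
  apply: rcauchy_cvg => e /cu[N hN]; exists N => m k Nm Nk.
  by rewrite (le_trans (uB _ _ _ _))// hN.
have [l hl] := choice H.
exists (\matrix_(i, j) l (i, j) : 'M[A]_n) => e e0.
pose d := e / (n * n)%:R.
(* without entries [d] would be 0 *)
have [n0|n0] := posnP (n * n)%N.
  exists 0%N => k _; rewrite rn_mxalg (le_trans (mxnorm_le_sum _))//.
  rewrite big1 ?ltW// => i _; exfalso; move: n0 => /eqP.
  by case: n i => [[]|].
have d0 : 0 < d by rewrite divr_gt0// ltr0n.
have [N hN] := uniform_threshold (fun ij => hl ij _ d0).
exists N => k /hN Nk; rewrite rn_mxalg (le_trans (mxnorm_le_sum _))//.
rewrite pair_big/= (@le_trans _ _ (\sum_(ij : 'I_n * 'I_n) d))//.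
  by apply: ler_sum => ij _; rewrite !mxE; case: ij (Nk ij).
by rewrite sumr_const card_prod !card_ord -mulr_natr divfK// pnatr_eq0 -lt0n.
Qed.

HB.instance Definition _ := Uniform_isComplete.Build M mxalg_complete.

Lemma mxalg_scaleAl (z : R[i]) (a b : M) :
  z *: ((a : 'M[A]_n) *m b : M) = ((z *: a : M) : 'M[A]_n) *m b.
Proof.
apply/matrixP => i j; rewrite !mxE scaler_sumr; apply: eq_bigr => k _.
by rewrite !mxE scAl.
Qed.

Lemma mxalg_scaleAr (z : R[i]) (a b : M) :
  z *: ((a : 'M[A]_n) *m b : M) = (a : 'M[A]_n) *m (z *: b : M).
Proof.
apply/matrixP => i j; rewrite !mxE scaler_sumr; apply: eq_bigr => k _.
by rewrite !mxE scAr.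
Qed.

Lemma mxalg_starZ (z : R[i]) (a : M) :
  (mxstar (z *: a : M) : M) = z^*%R *: (mxstar a : M).
Proof. by apply/matrixP => i j; rewrite !mxE starZ. Qed.

Lemma mxalg_normM (a b : M) : `|((a : 'M[A]_n) *m b : M)| <= `|a| * `|b|.
Proof. by rewrite !rnE -rmorphM lecR !rn_mxalg mxnormM. Qed.

Lemma mxalg_norm (a : M) : `|(mxstar a *m (a : 'M[A]_n) : M)| = `|a| ^+ 2.
Proof. by rewrite !rnE -rmorphXn !rn_mxalg mxnorm_star_mul. Qed.

HB.instance Definition _ := isCstarAlgebra.Build R M
  (@mulmxA _ _ _ _ _) (@mul1mx _ _ _) (@mulmx1 _ _ _)
  (@mulmxDl _ _ _ _) (@mulmxDr _ _ _ _) mxalg_scaleAl mxalg_scaleAr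
  (@mxstarD R A n n) mxalg_starZ (@mxstarM R A n n n) (@mxstarK R A n n)
  mxalg_normM mxalg_norm.

End MatrixCstar.

(** * Diagonalization of positive definite scalar matrices *)

Section PositiveDefinite.
Local Open Scope sesquilinear_scope.
Variables (C : numClosedFieldType) (n : nat).

(** If [P] is unitary and [P *m M *m P ^t* = diag_mx D], take [L] to be [P] with its
    rows divided by the square roots of the entries of [D]. *)
Lemma hermitian_pd_diagonalization (M : 'M[C]_n) : M ^t* = M ->
  (forall v : 'rV_n, v != 0 -> 0 < (v *m M *m v ^t*) ord0 ord0) ->
  exists2 L : 'M[C]_n, L \in unitmx & L *m M *m L ^t* = 1%:M.
Proof.
move=> hM pM; have Mn : M \is normalmx by apply/normalmxP; rewrite hM.
have /orthomx_spectralP := Mn.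
set P := spectralmx M; set D := spectral_diag M => eM.
have Pu : P \is unitarymx by exact: spectral_unitarymx.
have PPs : P *m P ^t* = 1%:M by exact/unitarymxP.
have PMP : P *m M *m P ^t* = diag_mx D.
  by rewrite {1}eM !mulmxA mulmxV ?unitarymx_unit// mul1mx -mulmxA PPs mulmx1.
have D0 i : 0 < D ord0 i.
  have := pM (row i P); have -> : row i P != 0.
    apply/eqP => r0; have : row i (P *m P ^t*) = 0 by rewrite row_mul r0 mul0mx.
    by rewrite PPs => /rowP/(_ i)/eqP; rewrite !mxE eqxx oner_eq0.
  have -> : (row i P *m M *m (row i P) ^t*) ord0 ord0 = (P *m M *m P ^t*) i i.
    by rewrite -row_mul [LHS]mxE [RHS]mxE; apply: eq_bigr => k _; rewrite !mxE.
  by rewrite PMP mxE eqxx; apply.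
pose d := \row_i (sqrtC (D ord0 i))^-1.
have d0 i : 0 < d ord0 i by rewrite mxE invr_gt0 sqrtC_gt0.
exists (diag_mx d *m P).
  rewrite unitmx_mul (unitarymx_unit Pu) andbT unitmxE det_diag unitfE.
  by apply/prodf_neq0 => i _; rewrite gt_eqF.
rewrite trmx_mul map_mxM tr_diag_mx map_diag_mx.
set d' := map_mx _ d; have -> : d' = d.
  apply/rowP => i; rewrite [LHS]mxE; apply/CrealP; rewrite ger0_real// ltW//.
rewrite -!mulmxA [P *m _]mulmxA [P *m M *m _]mulmxA PMP !mulmx_diag.
rewrite -diag_const_mx; congr diag_mx; apply/rowP => i; rewrite !mxE.
have s0 : sqrtC (D ord0 i) != 0 by rewrite sqrtC_eq0 gt_eqF.
by rewrite -{2}(sqrtCK (D ord0 i)) expr2 mulfK// mulVf.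
Qed.
End PositiveDefinite.

(** * Scalar matrices over a C*-algebra *)

Section ScalarMatrices.
Local Open Scope sesquilinear_scope.
Variables (R : realType) (A : cstarAlgType R).

(** The embedding of complex matrices into matrices over [A]; linear maps are
    bimodule maps over its image, see [map_mx_scm]. *)
Definition scm m n (L : 'M[R[i]]_(m, n)) : 'M[A]_(m, n) :=
  map_mx (fun z => z *: (1 : A)) L.

Lemma scm_mull m n p (L : 'M[R[i]]_(m, n)) (a : 'M[A]_(n, p)) :
  scm L *m a = \matrix_(i, j) \sum_k L i k *: a k j.
Proof.
apply/matrixP => i j; rewrite !mxE; apply: eq_bigr => k _.
by rewrite mxE -scAl mul1r.
Qed.

Lemma scm_mulr m n p (a : 'M[A]_(m, n)) (L : 'M[R[i]]_(n, p)) :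
  a *m scm L = \matrix_(i, j) \sum_k L k j *: a i k.
Proof.
apply/matrixP => i j; rewrite !mxE; apply: eq_bigr => k _.
by rewrite mxE -scAr mulr1.
Qed.

Lemma scmM m n p (L : 'M[R[i]]_(m, n)) (K : 'M[R[i]]_(n, p)) :
  scm (L *m K) = scm L *m scm K.
Proof.
apply/matrixP => i j; rewrite scm_mull !mxE scaler_suml.
by apply: eq_bigr => k _; rewrite mxE scalerA.
Qed.

Lemma scmD m n (L K : 'M[R[i]]_(m, n)) : scm (L + K) = scm L + scm K.
Proof. by apply/matrixP => i j; rewrite !mxE scalerDl. Qed.

Lemma scm_scalar n (z : R[i]) : scm (z%:M : 'M[R[i]]_n) = (z *: (1 : A))%:M.
Proof.
apply/matrixP => i j; rewrite !mxE; case: (i == j) => //=.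
by rewrite !mulr0n scale0r.
Qed.

Lemma scm1 n : scm (1%:M : 'M[R[i]]_n) = 1%:M.
Proof. by rewrite scm_scalar scale1r. Qed.

Lemma scm_star m n (L : 'M[R[i]]_(m, n)) : scm (L ^t*) = mxstar (scm L).
Proof. by apply/matrixP => i j; rewrite mxstarE !mxE starZ star1. Qed.

End ScalarMatrices.

Arguments scm {R} A {m n}.

Lemma map_mx_scm (R : realType) (A B : cstarAlgType R) (phi : {linear A -> B})
    m n p q (L : 'M[R[i]]_(m, n)) (a : 'M[A]_(n, p)) (K : 'M[R[i]]_(p, q)) :
  map_mx phi (scm A L *m a *m scm A K) = scm B L *m map_mx phi a *m scm B K.
Proof.
rewrite !scm_mulr !scm_mull; apply/matrixP => i j; rewrite !mxE linear_sum.
apply: eq_bigr => k _; rewrite linearZ !mxE linear_sum; congr (_ *: _).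
by apply: eq_bigr => l _; rewrite linearZ mxE.
Qed.

Section ScalarPositivity.
Variables (R : realType) (A : cstarAlgType R).
Hypothesis A1 : (1 : A) <> 0.

Lemma scalar_inj (y z : R[i]) : y *: (1 : A) = z *: (1 : A) -> y = z.
Proof.
move=> /eqP; rewrite -subr_eq0 -scalerBl scaler_eq0 subr_eq0 => /orP[/eqP//|/eqP].
by [].
Qed.

Lemma cpos_scalar_ge0 (z : R[i]) : cpos (z *: (1 : A)) -> 0 <= z.
Proof.
move=> pz; have /scalar_inj/CrealP/complex_realP[r zr] : z^*%R *: (1 : A) = z *: (1 : A).
  by rewrite -{1}(star1 A) -starZ cpos_sa.
move: pz; rewrite zr ler0c => pr; rewrite leNgt; apply/negP => r0.
have : r%:C *: (1 : A) = 0 *: (1 : A).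
  rewrite scale0r; apply: cpos_anti => //; rewrite -scaleNr -rmorphN.
  by apply: cpos_scalar; rewrite oppr_ge0 ltW.
by move=> /scalar_inj/complexI r00; rewrite r00 ltxx in r0.
Qed.

End ScalarPositivity.

Section CornerPositivity.
Variables (R : realType) (C : cstarAlgType R).

(** The sum is a product [star d * d] with [d = star x * star l + star k], plus the
    conjugate of [1 - x * star x] by [star l]. *)
Lemma cpos_corner (l k x : C) : rn x <= 1 ->
  cpos (l * star l + l * x * star k + k * star x * star l + k * star k).
Proof.
move=> x1.
have -> : l * star l + l * x * star k + k * star x * star l + k * star k =
    star (star x * star l + star k) * (star x * star l + star k) +
    star (star l) * (1 - x * star x) * star l.
  rewrite starD !star_mul !starK mulrDr !mulrDl mulrBr mulrBl mulr1 !mulrA.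
  set u := l * x * star x * star l; rewrite [RHS]addrC.
  rewrite -(addrA (l * star l)) -[u + _ + _]addrA [RHS]addrA.
  by rewrite subrK -!addrA; congr (_ + _); rewrite addrCA.
apply: cposD; first exact: cpos_star_mul.
apply: cpos_conj; rewrite -[X in X - _]scale1C; apply: cpos_le_sub.
  by rewrite star_mul starK.
by rewrite rn_mul_star expr_le1// rn_ge0.
Qed.

End CornerPositivity.

(** * Positivity of the image of a corner *)

Section OffDiagonal.
Local Open Scope sesquilinear_scope.
Variables (R : realType) (A B : cstarAlgType R) (n : nat).
Variables (phi : {linear A -> B}).
Hypothesis A1 : (1 : A) <> 0.

Lemma scm_form_ge0 (L : 'M[R[i]]_n) :
  (forall v : 'cV[A]_n, cpos (ip v (scm A L *m v))) ->
  forall v : 'rV[R[i]]_n, 0 <= (v *m L *m v ^t*) ord0 ord0.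
Proof.
move=> H v; apply: (cpos_scalar_ge0 A1).
have := H (scm A (v ^t*)); congr cpos.
by rewrite /ip -scm_star trmxCK -mulmxA -!scmM mulmxA mxE.
Qed.

(** Adding [e] makes the matrix positive definite, hence invertible. *)
Lemma scm_eps_factor (L0 : 'M[R[i]]_n) (e : R) : 0 < e -> L0 ^t* = L0 ->
  (forall v : 'cV[A]_n, cpos (ip v (scm A L0 *m v))) ->
  exists2 L : 'M[R[i]]_n, L \in unitmx & L *m (L0 + e%:C%:M) *m L ^t* = 1%:M.
Proof.
move=> e0 hL /scm_form_ge0 pL; apply: hermitian_pd_diagonalization.
  rewrite linearD/= map_mxD hL; congr (_ + _).
  by rewrite tr_scalar_mx map_scalar_mx; congr (_%:M); exact: conjc_real.
move=> v v0; rewrite mulmxDr mulmxDl mxE ltr_wpDl//.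
rewrite mul_mx_scalar -scalemxAl mxE mulr_gt0 ?ltcR//.
by rewrite -dotmxE dotmx_is_dotmx.
Qed.

Hypothesis phi1 : forall a : 'M[A]_n, mxnorm (map_mx phi a) <= mxnorm a.
Variables (La Mu : 'M[R[i]]_n) (a : 'M[A]_n).
Hypothesis hLa : La ^t* = La.
Hypothesis hMu : Mu ^t* = Mu.
Hypothesis form_pos : forall v w : 'cV[A]_n,
  cpos (ip v (scm A La *m v) + ip v (a *m w) + ip w (mxstar a *m v) +
        ip w (scm A Mu *m w)).

Lemma ip_scale (e : R) (v : 'cV[A]_n) : 0 <= e ->
  cpos (ip v (scm A (e%:C%:M) *m v)).
Proof.
move=> e0; rewrite scm_scalar.
have -> : (e%:C *: (1 : A))%:M *m v = cr v (e%:C *: (1 : A)).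
  by apply/colP => i; rewrite mul_scalar_mx !mxE -scAl -scAr mul1r mulr1.
by rewrite ip_crr -scAr mulr1; apply: cposZ => //; exact: ip_pos.
Qed.

(** After the congruence by [L] and [K] both diagonal blocks are the identity, and
    the form at [- (y *m w)] and [w] is the inner product of [w] with itself
    minus that of [y *m w]. *)
Lemma congruence_contraction (e : R) (L K : 'M[R[i]]_n) : 0 < e ->
  L *m (La + e%:C%:M) *m L ^t* = 1%:M -> K *m (Mu + e%:C%:M) *m K ^t* = 1%:M ->
  mxnorm (scm A L *m a *m scm A (K ^t*)) <= 1.
Proof.
move=> e0 eL eK; set y := scm A L *m a *m scm A (K ^t*).
have form1 (v w : 'cV[A]_n) :
    cpos (ip v v + ip v (y *m w) + ip (y *m w) v + ip w w).
  have := cposD (form_pos (scm A (L ^t*) *m v) (scm A (K ^t*) *m w))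
    (cposD (ip_scale (scm A (L ^t*) *m v) (ltW e0))
           (ip_scale (scm A (K ^t*) *m w) (ltW e0))).
  have aux (M0 P : 'M[R[i]]_n) (u : 'cV[A]_n) :
      P *m (M0 + e%:C%:M) *m P ^t* = 1%:M ->
      ip (scm A (P ^t*) *m u) (scm A M0 *m (scm A (P ^t*) *m u)) +
      ip (scm A (P ^t*) *m u) (scm A (e%:C%:M) *m (scm A (P ^t*) *m u)) = ip u u.
    move=> eP; rewrite -ipDr -mulmxDl -scmD mulmxA -scmM scm_star -ip_mulmx.
    by rewrite mulmxA -scmM mulmxA eP scm1 mul1mx.
  have e1 := aux _ _ v eL; have e2 := aux _ _ w eK.
  have e3 : ip (scm A (L ^t*) *m v) (a *m (scm A (K ^t*) *m w)) = ip v (y *m w).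
    by rewrite scm_star -ip_mulmx !mulmxA.
  have e4 : ip (scm A (K ^t*) *m w) (mxstar a *m (scm A (L ^t*) *m v)) = ip (y *m w) v.
    by rewrite ip_mulmx mxstarK -ip_star e3 ip_star.
  congr cpos; rewrite -e1 -e2 e3 e4.
  by rewrite [LHS](AC (4*2) (1*5*2*3*(4*6))).
apply: mxnorm_le => // w; rewrite mul1r; apply: cvnorm_le_sqr => //.
  exact: cvnorm_ge0.
rewrite cvnorm_sqr; apply: cpos_mono; first exact: ip_pos.
have := form1 (- (y *m w)) w.
by rewrite !ipNl ipNr opprK subrr add0r addrC.
Qed.

(** [map_mx phi] commutes with multiplication by scalar matrices, so it maps the
    contraction of [congruence_contraction] to the contraction
    [x = L *m map_mx phi a *m K ^t*], and the sum is the one in [cpos_corner] for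
    the inverses of [L] and [K]. *)
Lemma corner_positive_eps (e : R) : 0 < e ->
  cpos ((scm B (La + e%:C%:M) + map_mx phi a + mxstar (map_mx phi a) +
        scm B (Mu + e%:C%:M) : 'M[B]_n) : mxalg B n).
Proof.
move=> e0.
have pL (v : 'cV[A]_n) : cpos (ip v (scm A La *m v)).
  by have := form_pos v 0; rewrite !mulmx0 !ip0r !ip0l !addr0.
have pM (v : 'cV[A]_n) : cpos (ip v (scm A Mu *m v)).
  by have := form_pos 0 v; rewrite !mulmx0 !ip0r !ip0l !add0r.
have [L uL eL] := scm_eps_factor e0 hLa pL.
have [K uK eK] := scm_eps_factor e0 hMu pM.
pose x := map_mx phi (scm A L *m a *m scm A (K ^t*)).
have x1 : rn (x : mxalg B n) <= 1.
  by rewrite rn_mxalg (le_trans (phi1 _))// (congruence_contraction e0).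
have := cpos_corner (scm B (invmx L) : mxalg B n) (scm B (invmx K) : mxalg B n) x1.
have invE (P M0 : 'M[R[i]]_n) : P \in unitmx -> P *m M0 *m P ^t* = 1%:M ->
    (scm B (invmx P) : 'M[B]_n) *m mxstar (scm B (invmx P)) = scm B M0.
  move=> uP eP; rewrite -scm_star -scmM; congr scm.
  have PV : P ^t* *m (invmx P) ^t* = 1%:M.
    by rewrite -map_mxM -trmx_mul mulVmx// trmx1 map_mx1.
  transitivity (invmx P *m (P *m M0 *m P ^t*) *m (invmx P) ^t*).
    by rewrite eP mulmx1.
  by rewrite !mulmxA mulVmx// mul1mx -mulmxA PV mulmx1.
have ephi : scm B (invmx L) *m x *m mxstar (scm B (invmx K)) = map_mx phi a.
  have KV : K ^t* *m (invmx K) ^t* = 1%:M.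
    by rewrite -map_mxM -trmx_mul mulVmx// trmx1 map_mx1.
  rewrite /x map_mx_scm -scm_star !mulmxA -scmM mulVmx// scm1 mul1mx.
  by rewrite -mulmxA -scmM KV scm1 mulmx1.
have ephi_star : scm B (invmx K) *m mxstar x *m mxstar (scm B (invmx L)) =
    mxstar (map_mx phi a).
  by rewrite -ephi !mxstarM mxstarK mulmxA.
by rewrite -(invE _ _ uL eL) -(invE _ _ uK eK) -ephi_star -ephi.
Qed.

Lemma corner_positive :
  cpos ((scm B La + map_mx phi a + mxstar (map_mx phi a) + scm B Mu : 'M[B]_n)
        : mxalg B n).
Proof.
apply: cpos_eps => e e0; have e20 : 0 < e / 2 by rewrite divr_gt0.
have := corner_positive_eps e20; congr cpos.
have -> : (e%:C *: (1 : mxalg B n)) =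
    (scm B ((e / 2)%:C%:M) + scm B ((e / 2)%:C%:M) : 'M[B]_n).
  rewrite -scmD -raddfD/= -rmorphD/= -splitr scm_scalar.
  by apply/matrixP => i j; rewrite !mxE -scalerMnr.
rewrite !scmD.
by rewrite [LHS](AC (4*2) ((1*3*4*5)*(2*6))).
Qed.

End OffDiagonal.

(** * Extension of an off-diagonal corner *)

Lemma big_ord2 (V : nmodType) (F : 'I_2 -> V) : \sum_i F i = F ord0 + F ord_max.
Proof.
rewrite !big_ord_recl big_ord0 addr0; congr (_ + F _); exact: val_inj.
Qed.

Section Wittstock.
Local Open Scope sesquilinear_scope.
Variables (R : realType) (A B : cstarAlgType R).

Let i0 : 'I_2 := ord0.
Let i1 : 'I_2 := ord_max.

Lemma ip_sumr n (I : Type) (r : seq I) (v : 'cV[A]_n) (F : I -> 'cV[A]_n) :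
  ip v (\sum_(i <- r) F i) = \sum_(i <- r) ip v (F i).
Proof. exact: (big_morph _ (ipDr v) (ip0r v)). Qed.

Lemma ip_suml n (I : Type) (r : seq I) (v : 'cV[A]_n) (F : I -> 'cV[A]_n) :
  ip (\sum_(i <- r) F i) v = \sum_(i <- r) ip (F i) v.
Proof.
by rewrite -ip_star ip_sumr star_sum; apply: eq_bigr => i _; rewrite ip_star.
Qed.

(** The inverse of the embedding of the scalars if [1 <> 0], extended by 0. *)
Definition scalar_part (a : A) : R[i] := xget 0 [set z | a = z *: (1 : A)].

Lemma scalar_partK (a : A) z : a = z *: (1 : A) -> scalar_part a *: (1 : A) = a.
Proof. by move=> az; rewrite /scalar_part; case: xgetP => [y _ ->|/(_ z)]. Qed.

Lemma scalar_partE z : (1 : A) <> 0 -> scalar_part (z *: (1 : A)) = z.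
Proof. by move=> A1; apply: (scalar_inj A1); exact: scalar_partK. Qed.

(** Paulsen's operator system: the matrices of size 2 whose diagonal entries are
    scalars. *)
Definition paulsen_system : set (mxalg A 2) :=
  [set T | (exists z, (T : 'M[A]_2) i0 i0 = z *: (1 : A)) /\
           (exists z, (T : 'M[A]_2) i1 i1 = z *: (1 : A))].

Lemma paulsen_operator_system : operator_system paulsen_system.
Proof.
split.
- by split; exists 1; rewrite mxE eqxx scale1r.
- move=> z S T [[a ha] [b hb]] [[c hc] [d hd]].
  by split; [exists (z * a + c) | exists (z * b + d)];
    rewrite !mxE ?ha ?hb ?hc ?hd scalerDl scalerA.
- move=> S [[a ha] [b hb]].
  by split; [exists a^*%R | exists b^*%R];
    rewrite [LHS]mxstarE ?ha ?hb starZ star1.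
Qed.

Variable phi : {linear A -> B}.

(** The sum of the four entries of Paulsen's map, which sends a matrix in the
    operator system to the matrix over [B] with the same scalars on the diagonal
    and with [phi] applied to the corners.  Adding up the entries turns it into a
    map with values in [B], to which the injectivity of [B] applies; no matrix
    algebra over [B] has to be shown injective. *)
Definition paulsen_map (T : mxalg A 2) : B :=
  scalar_part ((T : 'M[A]_2) i0 i0) *: (1 : B) + phi ((T : 'M[A]_2) i0 i1) +
  star (phi (star ((T : 'M[A]_2) i1 i0))) +
  scalar_part ((T : 'M[A]_2) i1 i1) *: (1 : B).

Hypothesis A1 : (1 : A) <> 0.

Lemma paulsen_linear : linear_on paulsen_system paulsen_map.
Proof.
move=> z S T [[a ha] [b hb]] [[c hc] [d hd]]; rewrite /paulsen_map !mxE.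
rewrite ha hb hc hd !scalerA -!scalerDl !scalar_partE//.
rewrite !(linearD, starD, linearZ, starZ) /= ?conjcK ?conjCK.
rewrite !scalerA [a * z]mulrC [b * z]mulrC !scalerDl.
by rewrite [LHS](AC ((2*2)*2*2) (1*3*5*7*(2*4*6*8))).
Qed.

Hypothesis phi1 : forall n (a : 'M[A]_n), mxnorm (map_mx phi a) <= mxnorm a.

(** A positive matrix over the operator system has the shape of [corner_positive]:
    its diagonal blocks are scalar matrices, and its quadratic form on pairs of
    columns over [A] is a sum of inner products of vectors with themselves. *)
Lemma paulsen_completely_positive :
  completely_positive_on paulsen_system paulsen_map.
Proof.
move=> n p pS [q pq].
pose P s t : 'M[A]_n := \matrix_(i, j) (p i j : 'M[A]_2) s t.
have sp i j s : (p i j : 'M[A]_2) s s =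
    scalar_part ((p i j : 'M[A]_2) s s) *: (1 : A).
  case: (pS i j) => [[z hz] [y hy]].
  have [->|->] : s = i0 \/ s = i1.
    by case: s => [[|[|//]] k]; [left|right]; exact: val_inj.
  - by rewrite (scalar_partK hz).
  - by rewrite (scalar_partK hy).
pose La : 'M[R[i]]_n := \matrix_(i, j) scalar_part (P i0 i0 i j).
pose Mu : 'M[R[i]]_n := \matrix_(i, j) scalar_part (P i1 i1 i j).
have eLa : scm A La = P i0 i0 by apply/matrixP => i j; rewrite !mxE -sp.
have eMu : scm A Mu = P i1 i1 by apply/matrixP => i j; rewrite !mxE -sp.
have herm i j s t : (p i j : 'M[A]_2) s t = star ((p j i : 'M[A]_2) t s).
  have : mxstar p = p by rewrite pq mxstarM mxstarK.
  by move=> /matrixP/(_ i j) <-; rewrite mxstarE [LHS]mxstarE.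
have scherm (L : 'M[R[i]]_n) s : scm A L = P s s -> L ^t* = L.
  move=> eL; apply/matrixP => i j; apply: (scalar_inj A1).
  rewrite !mxE -[X in _ *: X](star1 A) -starZ.
  have eij k l : L k l *: (1 : A) = (p k l : 'M[A]_2) s s.
    by move/matrixP: eL => /(_ k l); rewrite !mxE.
  by rewrite !eij -herm.
have form (v w : 'cV[A]_n) :
  cpos (ip v (scm A La *m v) + ip v (P i0 i1 *m w) + ip w (mxstar (P i0 i1) *m v) +
        ip w (scm A Mu *m w)).
  pose x j : 'cV[A]_2 := \col_s (if s == i0 then v j ord0 else w j ord0).
  have -> : mxstar (P i0 i1) = P i1 i0.
    by apply/matrixP => i j; rewrite mxstarE !mxE -herm.
  rewrite eLa eMu.
  have -> : ip v (P i0 i0 *m v) + ip v (P i0 i1 *m w) + ip w (P i1 i0 *m v) +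
        ip w (P i1 i1 *m w) = \sum_i \sum_j ip (x i) ((p i j : 'M[A]_2) *m x j).
    rewrite !ipE -!big_split; apply: eq_bigr => i _ /=.
    rewrite !mxE !mulr_sumr -!big_split /=; apply: eq_bigr => j _.
    by rewrite ipE big_ord2 !mxE !big_ord2 !mxE /= !mulrDr !addrA.
  have -> : \sum_i \sum_j ip (x i) ((p i j : 'M[A]_2) *m x j) =
     \sum_k ip (\sum_i (q k i : 'M[A]_2) *m x i) (\sum_j (q k j : 'M[A]_2) *m x j).
    rewrite [RHS](eq_bigr (fun k => \sum_i \sum_j
        ip ((q k i : 'M[A]_2) *m x i) ((q k j : 'M[A]_2) *m x j))).
      rewrite [RHS]exchange_big; apply: eq_bigr => i _.
      rewrite [RHS]exchange_big; apply: eq_bigr => j _.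
      rewrite pq mxE (_ : (\sum_k _ * _) = (\sum_k mxstar (q k i : 'M[A]_2) *m
          (q k j : 'M[A]_2) : 'M[A]_2)); last first.
        by apply: eq_bigr => k _; rewrite mxstarE.
      rewrite mulmx_suml ip_sumr; apply: eq_bigr => k _.
      by rewrite -mulmxA ip_mulmx mxstarK.
    by move=> k _; rewrite ip_suml; apply: eq_bigr => i _; rewrite ip_sumr.
  by apply: cpos_sum => k _; exact: ip_pos.
have := corner_positive A1 (phi1 (n:=n)) (scherm _ _ eLa) (scherm _ _ eMu) form.
move=> /cge0P; congr cstar_ge0.
by apply/matrixP => i j; rewrite !mxE /paulsen_map -herm.
Qed.

Definition munit (s t : 'I_2) (a : A) : mxalg A 2 :=
  \matrix_(i, j) (if (i == s) && (j == t) then a else 0).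

End Wittstock.

(** Wittstock's decomposition in the form needed here: a completely bounded map is
    a corner of a completely positive one.  If [1 = 0] in [A], scalars cannot be
    read off their multiples of 1, but then [phi] vanishes. *)
Theorem off_diagonal_extension (R : realType) (A B : cstarAlgType R)
    (phi : {linear A -> B}) (C : R) : injective_cstar B ->
  (forall n (a : 'M[A]_n), mxnorm (map_mx phi a) <= C * mxnorm a) ->
  exists (psi : {linear mxalg A 2 -> B}) (c : R),
    completely_positive_on setT psi /\
    forall a, phi a = c%:C *: psi (munit ord0 ord_max a).
Proof.
move=> hB hphi; have [A1|/eqP A1] := eqVneq (1 : A) 0.
  have A0 (a : A) : a = 0 by rewrite -[a]mulr1 A1 mulr0.
  exists \0, 1; split => [n p _ _|a].
    exists 0; apply/matrixP => i j; rewrite !mxE big1// => k _.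
    by rewrite !mxE mulr0.
  by rewrite (A0 a) linear0 scaler0.
(* positive even if [C] is not *)
pose c := `|C| + 1; have c0 : 0 < c by rewrite ltr_wpDl.
have hpsi n (a : 'M[A]_n) : mxnorm (map_mx ((c^-1)%:C \*: phi) a) <= mxnorm a.
  have -> : map_mx ((c^-1)%:C \*: phi) a =
      ((c^-1)%:C *: (map_mx phi a : mxalg B n) : mxalg B n).
    by apply/matrixP => i j; rewrite !mxE.
  rewrite -rn_mxalg rnZp ?invr_ge0 ?(ltW c0)// mulrC ler_pdivrMr//.
  rewrite rn_mxalg (le_trans (hphi _ _))// mulrC ler_wpM2l ?mxnorm_ge0//.
  by rewrite (le_trans (ler_norm _))// /c lerDl.
have [psi [psiCP psiE]] := hB _ _ _ (paulsen_operator_system A)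
  (paulsen_linear _ A1) (paulsen_completely_positive A1 hpsi).
exists psi, c; split=> // a; rewrite psiE.
  have z0 : scalar_part (0 : A) *: (1 : B) = 0.
    by rewrite -{1}(scale0r (1 : A)) scalar_partE// scale0r.
  rewrite /paulsen_map !mxE /=.
  rewrite star0 linear0 scaler0 star0 z0 !addr0 add0r /=.
  by rewrite scaleCM divff ?gt_eqF// scale1C.
by split; exists 0; rewrite mxE /= scale0r.
Qed.

(** * Complete boundedness of the entries of a kernel *)

Section Compression.
Variables (R : realType) (A : cstarAlgType R) (m n : nat).
Implicit Types f g : 'I_m -> 'I_n.

(** The adjoint of [rowsub f], for injective [f]. *)
Definition spread f (u : 'cV[A]_m) : 'cV[A]_n :=
  \col_s (if [pick i | f i == s] is Some i then u i ord0 else 0).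

Lemma spreadE f u i : injective f -> spread f u (f i) ord0 = u i ord0.
Proof.
move=> fI; rewrite mxE; case: pickP => [j /eqP/fI ->//|/(_ i)].
by rewrite eqxx.
Qed.

Lemma spread0 f u s : s \notin codom f -> spread f u s ord0 = 0.
Proof.
move=> sf; rewrite mxE; case: pickP => [i /eqP fi|//].
by move: sf; rewrite -fi codom_f.
Qed.

Lemma sum_codom f (V : nmodType) (F : 'I_n -> V) : injective f ->
  \sum_s F s = \sum_i F (f i) + \sum_(s | s \notin codom f) F s.
Proof.
move=> fI; rewrite (bigID (mem (codom f)))/=; congr (_ + _).
rewrite -big_uniq /=; last exact/injectiveP.
by rewrite big_image.
Qed.

Lemma cvnorm_spread f u : injective f -> cvnorm (spread f u) = cvnorm u.
Proof.
move=> fI; rewrite !cvnormE !ipE (sum_codom _ fI) [X in _ + X]big1 ?addr0.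
  by congr (Num.sqrt (rn _)); apply: eq_bigr => i _; rewrite !spreadE.
by move=> s sf; rewrite spread0// mulr0.
Qed.

Lemma cvnorm_rowsub f (w : 'cV[A]_n) : injective f -> cvnorm (rowsub f w) <= cvnorm w.
Proof.
move=> fI; rewrite !cvnormE ler_wsqrtr// !ipE; apply: cpos_mono.
  by apply: cpos_sum => i _; exact: cpos_star_mul.
rewrite (sum_codom (fun s => star (w s ord0) * w s ord0) fI).
have -> : \sum_i star (rowsub f w i ord0) * rowsub f w i ord0 =
    \sum_i star (w (f i) ord0) * w (f i) ord0.
  by apply: eq_bigr => i _; rewrite !mxE.
rewrite addrAC subrr add0r; apply: cpos_sum => s _; exact: cpos_star_mul.
Qed.

Lemma mxnorm_mxsub f g (b : 'M[A]_n) : injective f -> injective g ->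
  mxnorm (mxsub f g b) <= mxnorm b.
Proof.
move=> fI gI; apply: mxnorm_le => [|u]; first exact: mxnorm_ge0.
have -> : mxsub f g b *m u = rowsub f (b *m spread g u).
  apply/colP => i; rewrite !mxE (sum_codom _ gI) [X in _ + X]big1 ?addr0.
    by apply: eq_bigr => j _; rewrite spreadE// mxE.
  by move=> s sg; rewrite spread0// mulr0.
by rewrite (le_trans (cvnorm_rowsub _ fI))// (le_trans (mxnormP _ _))// cvnorm_spread.
Qed.

Lemma mxnorm_mxsub_full f g (b : 'M[A]_n) : injective f -> injective g ->
  (forall s t, (s \notin codom f) || (t \notin codom g) -> b s t = 0) ->
  mxnorm b <= mxnorm (mxsub f g b).
Proof.
move=> fI gI b0; apply: mxnorm_le => [|v]; first exact: mxnorm_ge0.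
have -> : b *m v = spread f (mxsub f g b *m rowsub g v).
  apply/colP => s; rewrite mxE; have [/codomP[i ->]|sf] := boolP (s \in codom f).
    rewrite spreadE// mxE (sum_codom _ gI) [X in _ + X]big1 ?addr0.
      by apply: eq_bigr => j _; rewrite !mxE.
    by move=> t tg; rewrite b0 ?mul0r// tg orbT.
  by rewrite spread0// big1// => t _; rewrite b0 ?mul0r// sf.
rewrite cvnorm_spread// (le_trans (mxnormP _ _))// ler_wpM2l ?mxnorm_ge0//.
exact: cvnorm_rowsub.
Qed.

End Compression.

(** Placing a matrix at the positions [(s, t)] of the blocks, with zeros elsewhere,
    changes neither its norm nor the norm of its image. *)
Lemma completely_bounded_entry (R : realType) (A B : cstarAlgType R) (X : Type)
    (k : X -> X -> boundedLinear A B) n (x : 'I_n -> X) (s t : 'I_n) :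
  completely_bounded (kernel_mx k x) ->
  exists C : R, forall m (a : 'M[A]_m),
    mxnorm (map_mx (k (x s) (x t)) a) <= C * mxnorm a.
Proof.
(* [C] may be negative if there are only matrices of norm 0 *)
move=> [C hC]; exists `|C| => m a.
pose b i j : 'M[A]_n := \matrix_(p, q) (if (p == s) && (q == t) then a i j else 0).
pose f (i : 'I_m) := tagnat.Rank (p_ := fun=> n) i s.
pose g (i : 'I_m) := tagnat.Rank (p_ := fun=> n) i t.
have fI : injective f by move=> i j /tagnat.rank_inj/(congr1 tag).
have gI : injective g by move=> i j /tagnat.rank_inj/(congr1 tag).
have blockE (D : cstarAlgType R) (c : 'I_m -> 'I_m -> 'M[D]_n) i j p q :
    (\mxblock_(i, j) c i j) (tagnat.Rank (p_ := fun=> n) i p)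
      (tagnat.Rank (p_ := fun=> n) j q) = c i j p q.
  by have /matrixP/(_ p q) := mxblockK c i j; rewrite mxE.
have eB : map_mx (k (x s) (x t)) a =
    mxsub f g (\mxblock_(i < m, j < m) kernel_mx k x (b i j)).
  by apply/matrixP => i j; rewrite [LHS]mxE [RHS]mxE blockE !mxE !eqxx.
have eA : mxsub f g (\mxblock_(i < m, j < m) b i j) = a.
  by apply/matrixP => i j; rewrite [LHS]mxE blockE mxE !eqxx.
rewrite eB (le_trans (mxnorm_mxsub _ fI gI))// (le_trans (hC _ _))//.
rewrite (le_trans (ler_wpM2r (mxnorm_ge0 _) (ler_norm C)))// ler_wpM2l//.
rewrite -[in leRHS]eA; apply: mxnorm_mxsub_full => // u v.
rewrite -(tagnat.sig2K u) -(tagnat.sig2K v) blockE mxE.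
case: (tagnat.sig2 u =P s) => [->|_] //=; case: (tagnat.sig2 v =P t) => [->|_] //=.
by rewrite -/(f _) -/(g _) !codom_f.
Qed.

Lemma completely_bounded_kernel_entry (R : realType) (A B : cstarAlgType R)
    (X : Type) (k : X -> X -> boundedLinear A B) (x y : X) :
  completely_bounded_kernel k ->
  exists C : R, forall m (a : 'M[A]_m),
    mxnorm (map_mx (k x y) a) <= C * mxnorm a.
Proof.
move=> hk; have [->|xy] := pselect (x = y).
  have inj1 : injective (fun _ : 'I_1 => y) by move=> i j _; rewrite !ord1.
  exact: (completely_bounded_entry ord0 ord0 (hk _ _ inj1)).
pose z (i : 'I_2) := if i == ord0 then x else y.
have inj2 : injective z.
  move=> i j; rewrite /z; case: i => [[|[|//]] ?]; case: j => [[|[|//]] ?] //=.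
  - by move=> _; exact: val_inj.
  - by move=> e; case: (xy (esym e)).
  - by move=> _; exact: val_inj.
exact: (completely_bounded_entry ord0 ord_max (hk _ _ inj2)).
Qed.

(** * Formal sums over a positive kernel *)

Lemma le_of_sqr (R : realType) (x y : R) :
  0 <= x -> 0 <= y -> x ^+ 2 <= y * x -> x <= y.
Proof.
move=> x0 y0; have [->//|xn0] := eqVneq x 0.
have x_gt0 : 0 < x by rewrite lt_neqAle eq_sym xn0.
by rewrite expr2 ler_pM2r.
Qed.

Section PositiveKernel.
Variables (R : realType) (G : Type) (B : cstarAlgType R).
Implicit Types (u v w : seq (G * B)) (f : G -> B) (b c : B).

Definition pairing u f : B := \sum_(x <- u) star x.2 * f x.1.

Definition span_fun (K : G -> G -> B) w : G -> B :=
  fun g => \sum_(y <- w) K g y.1 * y.2.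

Definition rscale u b := [seq (x.1, x.2 * b) | x <- u].

Lemma pairing_cat u v f : pairing (u ++ v) f = pairing u f + pairing v f.
Proof. exact: big_cat. Qed.

Lemma pairing_rscale u b f : pairing (rscale u b) f = star b * pairing u f.
Proof.
rewrite /pairing big_map mulr_sumr; apply: eq_bigr => x _ /=.
by rewrite star_mul mulrA.
Qed.

Lemma pairing_ext u f f' : (forall g, f g = f' g) -> pairing u f = pairing u f'.
Proof. by move=> ff'; apply: eq_bigr => x _; rewrite ff'. Qed.

Lemma pairingD u f f' : pairing u (fun g => f g + f' g) = pairing u f + pairing u f'.
Proof. by rewrite -big_split; apply: eq_bigr => x _; rewrite mulrDr. Qed.

Lemma pairingN u f : pairing u (fun g => - f g) = - pairing u f.
Proof.
rewrite /pairing (big_morph (fun x : B => - x) (@opprD _) (@oppr0 _)).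
by apply: eq_bigr => x _; rewrite mulrN.
Qed.

Lemma pairingB u f f' : pairing u (fun g => f g - f' g) = pairing u f - pairing u f'.
Proof. by rewrite (pairingD u f (fun g => - f' g)) pairingN. Qed.

Lemma pairingZ u (z : R[i]) f : pairing u (fun g => z *: f g) = z *: pairing u f.
Proof.
by rewrite /pairing scaler_sumr; apply: eq_bigr => x _; rewrite scAr.
Qed.

Lemma pairing_mulr u f b : pairing u (fun g => f g * b) = pairing u f * b.
Proof. by rewrite /pairing mulr_suml; apply: eq_bigr => x _; rewrite mulrA. Qed.

(** A list stands for the formal sum of the kernel functions at its points [x.1],
    multiplied on the right by [x.2]; [form] is their inner product.  Lists spare
    the construction of a free module, since only the functions [span_fun] that
    they represent become vectors. *)
Definition form K u w := pairing u (span_fun K w).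

Record pos_kernel := PosKernel {
  kfun :> G -> G -> B;
  kfun_star : forall g h, star (kfun g h) = kfun h g;
  kfun_pos : forall u, cpos (form kfun u u) }.

Variable K : pos_kernel.

Lemma form_star u w : star (form K u w) = form K w u.
Proof.
rewrite /form /pairing star_sum.
rewrite (eq_bigr (fun x => \sum_(y <- w) star y.2 * (K y.1 x.1 * x.2))); last first.
  move=> x _; rewrite star_mul starK star_sum mulr_suml; apply: eq_bigr => y _.
  by rewrite star_mul kfun_star mulrA.
rewrite exchange_big; apply: eq_bigr => y _; rewrite mulr_sumr.
by apply: eq_bigr.
Qed.

Lemma form_catl u v w : form K (u ++ v) w = form K u w + form K v w.
Proof. exact: pairing_cat. Qed.

Lemma form_catr u v w : form K w (u ++ v) = form K w u + form K w v.
Proof. by rewrite -form_star form_catl starD !form_star. Qed.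

Lemma form_rscalel u w b : form K (rscale u b) w = star b * form K u w.
Proof. exact: pairing_rscale. Qed.

Lemma form_rscaler u w b : form K w (rscale u b) = form K w u * b.
Proof. by rewrite -form_star form_rscalel star_mul starK form_star. Qed.

Definition nrm u : R := Num.sqrt (rn (form K u u)).

Lemma nrm_ge0 u : 0 <= nrm u.
Proof. exact: sqrtr_ge0. Qed.

Lemma nrm_sqr u : nrm u ^+ 2 = rn (form K u u).
Proof. by rewrite sqr_sqrtr ?rn_ge0. Qed.

Lemma form_cauchy_schwarz u w : rn (form K u w) <= nrm u * nrm w.
Proof.
rewrite -(ler_pXn2r (_ : 0 < 2)%N) ?nnegrE ?rn_ge0 ?mulr_ge0 ?nrm_ge0//.
rewrite exprMn !nrm_sqr; apply: gram_cauchy_schwarz => b c.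
have := kfun_pos K (rscale u b ++ rscale w c).
by rewrite form_catl !form_catr !form_rscaler !form_rscalel form_star !addrA.
Qed.

(** [f] is within distance [e] of the formal sum [u], as a functional on formal
    sums.  This describes the closure of the span without a norm on all
    functions and without a quotient: two formal sums of distance 0 represent the
    same function. *)
Definition approx f u (e : R) :=
  forall w, rn (pairing w f - form K w u) <= e * nrm w.

Definition in_closure f := forall e : R, 0 < e -> exists u, approx f u e.

Definition bounded_by f (M : R) := forall w, rn (pairing w f) <= M * nrm w.

Lemma approx_bounded f u e : approx f u e -> bounded_by f (nrm u + e).
Proof.
move=> fu w; rewrite -(subrK (form K w u) (pairing w f)) (le_trans (rnD _ _))//.
by rewrite addrC mulrDl lerD// mulrC form_cauchy_schwarz.
Qed.

(** Test [f] against its own approximant [u]. *)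
Lemma approx_nrm_le f u e M : 0 <= e -> 0 <= M -> approx f u e -> bounded_by f M ->
  nrm u <= M + e.
Proof.
move=> e0 M0 fu fM; apply: le_of_sqr; rewrite ?nrm_ge0 ?addr_ge0//.
rewrite nrm_sqr -[form K u u](subrK (pairing u f)) (le_trans (rnD _ _))//.
by rewrite addrC mulrDl lerD// rnBC.
Qed.

Lemma approx_diff f u v d e : 0 <= d -> 0 <= e -> approx f u d -> approx f v e ->
  nrm (u ++ rscale v (-1)) <= d + e.
Proof.
move=> d0 e0 fu fv; set s := u ++ _; apply: le_of_sqr; rewrite ?nrm_ge0 ?addr_ge0//.
rewrite nrm_sqr {2}/s form_catr form_rscaler mulrN mulr1 mulrDl.
rewrite (le_trans (rn_triangle (pairing s f) _ _))// lerD// rnBC; exact: fu.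
Qed.

Lemma pairing_diff_le f u v d e g M : 0 <= d -> 0 <= e -> 0 <= M ->
  approx f u d -> approx f v e -> bounded_by g M ->
  rn (pairing u g - pairing v g) <= M * (d + e).
Proof.
move=> d0 e0 M0 fu fv gM.
have -> : pairing u g - pairing v g = pairing (u ++ rscale v (-1)) g.
  by rewrite pairing_cat pairing_rscale starN star1 mulN1r.
by rewrite (le_trans (gM _))// ler_wpM2l// (approx_diff d0 e0 fu fv).
Qed.

Lemma in_closure0 : in_closure (fun=> 0).
Proof.
move=> e e0; exists [::] => w; rewrite /form /span_fun.
rewrite -pairingB /pairing big1 ?rn0 ?mulr_ge0 ?nrm_ge0 ?ltW// => x _.
by rewrite big_nil subrr mulr0.
Qed.

Lemma in_closureD f f' : in_closure f -> in_closure f' ->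
  in_closure (fun g => f g + f' g).
Proof.
move=> hf hf' e e0; have e20 : 0 < e / 2 by rewrite divr_gt0.
have [u fu] := hf _ e20; have [u' fu'] := hf' _ e20; exists (u ++ u') => w.
rewrite pairingD form_catr opprD addrACA (le_trans (rnD _ _))//.
by rewrite (splitr e) mulrDl lerD.
Qed.

Lemma in_closure_mulr f b : in_closure f -> in_closure (fun g => f g * b).
Proof.
move=> hf e e0; have b1 : 0 < rn b + 1 by rewrite ltr_wpDl ?rn_ge0.
have [u fu] := hf (e / (rn b + 1)) (divr_gt0 e0 b1); exists (rscale u b) => w.
rewrite pairing_mulr form_rscaler -mulrBl (le_trans (rnM _ _))//.
rewrite (le_trans (ler_wpM2r (rn_ge0 b) (fu w)))// mulrAC ler_wpM2r ?nrm_ge0//.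
by rewrite mulrAC ler_pdivrMr// ler_wpM2l ?(ltW e0)// lerDl.
Qed.

Lemma in_closureZ f (z : R[i]) : in_closure f -> in_closure (fun g => z *: f g).
Proof.
move=> hf; have := in_closure_mulr (z *: (1 : B)) hf; congr in_closure.
by apply/funext => g; rewrite -scAr mulr1.
Qed.

Lemma in_closure_span u : in_closure (span_fun K u).
Proof.
by move=> e e0; exists u => w; rewrite subrr rn0 mulr_ge0 ?nrm_ge0// ltW.
Qed.

(** The completion of the span of the kernel functions, realized inside the
    functions on [G]: a vector is determined by its inner products with the
    kernel functions. *)
Record hker := HKer { hfun :> G -> B; hfunP : in_closure hfun }.

Lemma hker_eq (f f' : hker) : (forall g, f g = f' g) -> f = f'.
Proof.
case: f f' => [f hf] [f' hf'] /= /funext e; rewrite e in hf *.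
by congr HKer; exact: Prop_irrelevance.
Qed.

End PositiveKernel.

(** * The Hilbert module of a positive kernel *)

Section HkerModule.
Variables (R : realType) (G : Type) (B : cstarAlgType R) (K : pos_kernel G B).
Local Notation H := (hker K).
Implicit Types (f g h : H) (u v w : seq (G * B)).

HB.instance Definition _ := gen_eqMixin H.
HB.instance Definition _ := gen_choiceMixin H.

Definition hzero : H := HKer (in_closure0 K).
Definition hadd f g : H := HKer (in_closureD (hfunP f) (hfunP g)).
Definition hscale (z : R[i]) f : H := HKer (in_closureZ z (hfunP f)).
Definition hopp f : H := hscale (-1) f.
Definition hract f (b : B) : H := HKer (in_closure_mulr b (hfunP f)).
Definition hspan u : H := HKer (in_closure_span K u).

Lemma haddA : associative hadd.
Proof. by move=> f g h; apply: hker_eq => x /=; rewrite addrA. Qed.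

Lemma haddC : commutative hadd.
Proof. by move=> f g; apply: hker_eq => x /=; rewrite addrC. Qed.

Lemma hadd0 : left_id hzero hadd.
Proof. by move=> f; apply: hker_eq => x /=; rewrite add0r. Qed.

Lemma haddN : left_inverse hzero hopp hadd.
Proof. by move=> f; apply: hker_eq => x /=; rewrite scaleN1r addNr. Qed.

HB.instance Definition _ := GRing.isZmodule.Build H haddA haddC hadd0 haddN.

Lemma hscaleA (y z : R[i]) f : hscale y (hscale z f) = hscale (y * z) f.
Proof. by apply: hker_eq => x /=; rewrite scalerA. Qed.

Lemma hscale1 : left_id 1 hscale.
Proof. by move=> f; apply: hker_eq => x /=; rewrite scale1r. Qed.

Lemma hscaleDr : right_distributive hscale +%R.
Proof. by move=> z f g; apply: hker_eq => x /=; rewrite scalerDr. Qed.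

Lemma hscaleDl f : {morph hscale^~ f : y z / y + z}.
Proof. by move=> y z; apply: hker_eq => x /=; rewrite scalerDl. Qed.

HB.instance Definition _ :=
  GRing.Zmodule_isLmodule.Build R[i] H hscaleA hscale1 hscaleDr hscaleDl.

Lemma hfunB f g x : (f - g) x = f x - g x.
Proof. by rewrite /= scaleN1r. Qed.

Lemma apx_exists f n : exists u, approx K f u (n.+1%:R^-1).
Proof. by apply: (hfunP f); rewrite invr_gt0 ltr0Sn. Qed.

(** A chosen sequence of approximants; by [hinner_cvg_approx] the inner product
    defined from it does not depend on the choice. *)
Definition apx f n := sval (cid (apx_exists f n)).

Lemma apxP f n : approx K f (apx f n) (n.+1%:R^-1).
Proof. by rewrite /apx; case: cid. Qed.

Lemma bounded_exists f : exists2 M, 0 <= M & bounded_by K f M.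
Proof.
have [u fu] := hfunP f ltr01; exists (nrm K u + 1).
  by rewrite addr_ge0 ?nrm_ge0 ?ler01.
exact: approx_bounded.
Qed.

Lemma apx_pairing_cauchy f g : rcauchy (fun n => pairing (apx f n) g).
Proof.
have [M M0 gM] := bounded_exists g.
have M1 : 0 < 2 * (M + 1) by rewrite mulr_gt0 ?ltr0n// ltr_wpDl.
move=> e e0; have [N hN] := invn_small (divr_gt0 e0 M1).
exists N => m n Nm Nn.
have i0 (k : nat) : 0 <= k.+1%:R^-1 :> R by rewrite invr_ge0.
rewrite (le_trans (pairing_diff_le (i0 m) (i0 n) M0 (apxP f m) (apxP f n) gM))//.
have := hN _ Nm; have := hN _ Nn; rewrite !ler_pdivlMr//.
have := i0 m; have := i0 n; move: (m.+1%:R^-1 : R) (n.+1%:R^-1 : R) => x y; nra.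
Qed.

Lemma hinner_exists f g : exists b, rcvg (fun n => pairing (apx f n) g) b.
Proof. exact: rcauchy_cvg (apx_pairing_cauchy f g). Qed.

Definition hinner f g : B := sval (cid (hinner_exists f g)).

Lemma hinner_cvg f g : rcvg (fun n => pairing (apx f n) g) (hinner f g).
Proof. by rewrite /hinner; case: cid. Qed.

Lemma hinner_approx f g u e M : 0 <= e -> 0 <= M -> approx K f u e ->
  bounded_by K g M -> rn (hinner f g - pairing u g) <= M * e.
Proof.
move=> e0 M0 fu gM; apply/ler_addgt0Pr => d d0.
have M1 : 0 < M + 1 by rewrite ltr_wpDl.
have d20 : 0 < d / 2 by rewrite divr_gt0.
have [N1 hN1] := invn_small (divr_gt0 d20 M1).
have [N2 hN2] := hinner_cvg f g d20.
pose n := maxn N1 N2; have i0 : 0 <= n.+1%:R^-1 :> R by rewrite invr_ge0.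
have := rn_triangle (pairing (apx f n) g) (hinner f g) (pairing u g).
have := hN2 n (leq_maxr _ _); rewrite rnBC.
have := pairing_diff_le i0 e0 M0 (apxP f n) fu gM.
have := hN1 n (leq_maxl _ _); rewrite ler_pdivlMr//.
move: (n.+1%:R^-1 : R) i0 => x x0; nra.
Qed.

Lemma hinner_cvg_approx f g (u : nat -> seq (G * B)) (e : nat -> R) :
  (forall n, 0 <= e n) -> (forall n, approx K f (u n) (e n)) ->
  (forall d : R, 0 < d -> exists N, forall n, (N <= n)%N -> e n <= d) ->
  rcvg (fun n => pairing (u n) g) (hinner f g).
Proof.
move=> e0 fu ecvg d d0; have [M M0 gM] := bounded_exists g.
have M1 : 0 < M + 1 by rewrite ltr_wpDl.
have [N hN] := ecvg _ (divr_gt0 d0 M1); exists N => n Nn.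
rewrite rnBC (le_trans (hinner_approx (e0 n) M0 (fu n) gM))//.
have := hN n Nn; rewrite ler_pdivlMr//; have := e0 n; nra.
Qed.

(** The description of the inner product that treats both arguments alike; symmetry
    and positivity pass to the limit from [form]. *)
Lemma hinner_form_cvg f g :
  rcvg (fun n => form K (apx f n) (apx g n)) (hinner f g).
Proof.
have [M M0 fM] := bounded_exists f.
move=> d d0; have M1 : 0 < M + 1 by rewrite ltr_wpDl.
have d20 : 0 < d / 2 by rewrite divr_gt0.
have [N1 hN1] := invn_small (divr_gt0 d20 M1).
have [N2 hN2] := hinner_cvg f g d20.
exists (maxn N1 N2) => n; rewrite geq_max => /andP[n1 n2].
have i0 : 0 <= n.+1%:R^-1 :> R by rewrite invr_ge0.
have i1 : n.+1%:R^-1 <= 1 :> R by rewrite invf_le1 ?ltr0Sn// ler1n.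
have nu := approx_nrm_le i0 M0 (apxP f n) fM.
have := rn_triangle (pairing (apx f n) g) (form K (apx f n) (apx g n)) (hinner f g).
have h1 := apxP g n (apx f n); rewrite rnBC in h1.
have h2 : n.+1%:R^-1 * nrm K (apx f n) <= n.+1%:R^-1 * (M + 1).
  by rewrite ler_wpM2l// (le_trans nu)// lerD2l.
have := hN1 n n1; rewrite ler_pdivlMr//; have := hN2 n n2.
by move: h1 h2; move: (n.+1%:R^-1 : R) (nrm K _) => x y; lra.
Qed.

Lemma hinnerDr f g h : hinner f (g + h) = hinner f g + hinner f h.
Proof.
apply: rcvg_uniq (hinner_cvg f (g + h)) _.
apply: rcvg_near (rcvgD (hinner_cvg f g) (hinner_cvg f h)); exists 0%N => n _.
by rewrite -pairingD.
Qed.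

Lemma hinnerZr (z : R[i]) f g : hinner f (z *: g) = z *: hinner f g.
Proof.
apply: rcvg_uniq (hinner_cvg f (z *: g)) _.
apply: rcvg_near (rcvgZ z (hinner_cvg f g)); exists 0%N => n _.
by rewrite -pairingZ.
Qed.

Lemma hinner_ract f g (b : B) : hinner f (hract g b) = hinner f g * b.
Proof.
apply: rcvg_uniq (hinner_cvg f (hract g b)) _.
apply: rcvg_near (rcvgM (hinner_cvg f g) (rcvg_cst b)); exists 0%N => n _.
by rewrite -pairing_mulr.
Qed.

Lemma hinner_star f g : star (hinner f g) = hinner g f.
Proof.
apply: rcvg_uniq (rcvg_star (hinner_form_cvg f g)) _.
apply: rcvg_near (hinner_form_cvg g f); exists 0%N => n _.
by rewrite form_star.
Qed.

Lemma hinner_pos f : cpos (hinner f f).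
Proof. by apply: cpos_lim (hinner_form_cvg f f) => n; exact: kfun_pos. Qed.

Lemma hinner_ge0 f : cstar_ge0 (hinner f f).
Proof. by apply/cge0P; exact: hinner_pos. Qed.

Lemma hinnerDl f g h : hinner (f + g) h = hinner f h + hinner g h.
Proof. by rewrite -hinner_star hinnerDr starD !hinner_star. Qed.

Lemma hinner_ractl f g (b : B) : hinner (hract f b) g = star b * hinner f g.
Proof. by rewrite -hinner_star hinner_ract star_mul hinner_star. Qed.

Definition hn f : R := Num.sqrt (rn (hinner f f)).

Lemma hn_ge0 f : 0 <= hn f. Proof. exact: sqrtr_ge0. Qed.

Lemma hn_sqr f : hn f ^+ 2 = rn (hinner f f).
Proof. by rewrite sqr_sqrtr ?rn_ge0. Qed.

Lemma hinner_cauchy_schwarz f g : rn (hinner f g) <= hn f * hn g.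
Proof.
rewrite -(ler_pXn2r (_ : 0 < 2)%N) ?nnegrE ?rn_ge0 ?mulr_ge0 ?hn_ge0//.
rewrite exprMn !hn_sqr; apply: gram_cauchy_schwarz => b c.
have := hinner_pos (hract f b + hract g c).
by rewrite hinnerDl !hinnerDr !hinner_ract !hinner_ractl hinner_star !addrA.
Qed.

Lemma hinner_span u f : hinner (hspan u) f = pairing u f.
Proof.
have [M M0 fM] := bounded_exists f.
have u0 : approx K (hspan u) u 0 by move=> w; rewrite subrr rn0 mul0r.
have := hinner_approx (lexx 0) M0 u0 fM; rewrite mulr0 => h.
by apply/eqP; rewrite -subr_eq0; apply/eqP/rn_eq0/le_anti; rewrite h rn_ge0.
Qed.

Lemma hn_span u : hn (hspan u) = nrm K u.
Proof. by rewrite /hn hinner_span. Qed.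

Lemma bounded_by_hn f : bounded_by K f (hn f).
Proof.
move=> w; rewrite -hinner_span (le_trans (hinner_cauchy_schwarz _ _))//.
by rewrite hn_span mulrC.
Qed.

(** By [approx_nrm_le] an approximant [u] of [f] with error [d] has norm at most
    [e + d], so that pairing [f] with [u] yields at most [e * (e + d)]. *)
Lemma hn_le f e : 0 <= e -> bounded_by K f e -> hn f <= e.
Proof.
move=> e0 fe; rewrite -(ler_pXn2r (_ : 0 < 2)%N) ?nnegrE ?hn_ge0// hn_sqr.
rewrite expr2; apply: ler_add_mul => // d d0.
have d20 : 0 < d / 2 by rewrite divr_gt0.
have [u fu] := hfunP f d20.
have := hinner_approx (ltW d20) e0 fu fe; have := fe u.
have := approx_nrm_le (ltW d20) e0 fu fe.
have := rnD (hinner f f - pairing u f) (pairing u f); rewrite subrK.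
move: (nrm K u) => x; nra.
Qed.

Lemma hnD f g : hn (f + g) <= hn f + hn g.
Proof.
apply: hn_le; first by rewrite addr_ge0 ?hn_ge0.
move=> w; rewrite (pairingD w f g) (le_trans (rnD _ _))// mulrDl lerD//;
  exact: bounded_by_hn.
Qed.

Lemma hinnerZl (z : R[i]) f g : hinner (z *: f) g = z^*%R *: hinner f g.
Proof. by rewrite -hinner_star hinnerZr starZ hinner_star. Qed.

Definition hnC f : R[i] := (hn f)%:C.

Lemma hnCD f g : hnC (f + g) <= hnC f + hnC g.
Proof. by rewrite /hnC -rmorphD lecR hnD. Qed.

Lemma hnCZ (z : R[i]) f : hnC (z *: f) = `|z| * hnC f.
Proof.
have nz : `|z| = (complex.Re `|z|)%:C by rewrite RRe_real ?normr_real.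
have z0 : 0 <= complex.Re `|z| by rewrite -lecR -nz normr_ge0.
rewrite nz /hnC -rmorphM; congr (_%:C).
rewrite /hn hinnerZr hinnerZl scalerA.
have -> : z * z^*%R = ((complex.Re `|z|) ^+ 2)%:C.
  transitivity (`|z| ^+ 2); first by rewrite sqr_normc.
  by rewrite {1}nz -rmorphXn.
by rewrite rnZp ?sqr_ge0// sqrtrM ?sqr_ge0// sqrtr_sqr ger0_norm.
Qed.

Lemma hfun_le f x : rn (f x) <= hn f * nrm K [:: (x, 1)].
Proof.
have := bounded_by_hn f [:: (x, 1)].
by rewrite /pairing big_seq1 /= star1 mul1r.
Qed.

Lemma hnC_eq0 f : hnC f = 0 -> f = 0.
Proof.
move=> /complexI f0; apply: hker_eq => x; apply/rn_eq0/le_anti.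
by rewrite rn_ge0 andbT (le_trans (hfun_le _ _))// f0 mul0r.
Qed.

HB.instance Definition _ := Lmodule_isNormed.Build R[i] H hnCD hnCZ hnC_eq0.

Lemma rn_hker f : rn f = hn f. Proof. by []. Qed.

Lemma rcvg_pairing (F : nat -> G -> B) (l : G -> B) w :
  (forall x, rcvg (fun n => F n x) (l x)) ->
  rcvg (fun n => pairing w (F n)) (pairing w l).
Proof.
move=> Fl; elim: w => [|x w IH].
  by apply: rcvg_near (rcvg_cst _); exists 0%N => n _; rewrite /pairing !big_nil.
rewrite {2}/pairing big_cons.
apply: rcvg_near (rcvgD (rcvgM (rcvg_cst (star x.2)) (Fl x.1)) IH).
by exists 0%N => n _; rewrite /pairing big_cons.
Qed.

(** A Cauchy sequence converges pointwise, and uniformly on formal sums of bounded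
    norm; the latter puts the limit in the closure. *)
Lemma hker_complete (F : set_system H) : ProperFilter F -> cauchy F -> cvg F.
Proof.
apply: complete_of_rcauchy => u cu.
have /choice[l hl] x : exists b, rcvg (fun n => u n x) b.
  apply: rcauchy_cvg => e e0.
  have n1 : 0 < nrm K [:: (x, 1)] + 1 by rewrite ltr_wpDl ?nrm_ge0.
  have [N hN] := cu _ (divr_gt0 e0 n1); exists N => m n Nm Nn.
  rewrite -hfunB (le_trans (hfun_le _ _))//.
  have := hN _ _ Nm Nn; rewrite rn_hker ler_pdivlMr//.
  have := hn_ge0 (u m - u n); nra.
have wl (e : R) : 0 < e -> exists N, forall n, (N <= n)%N ->
    forall w, rn (pairing w (u n) - pairing w l) <= e * nrm K w.
  move=> e0; have [N hN] := cu _ e0; exists N => n Nn w.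
  apply: (@rcvg_le _ _ (fun m => pairing w (u n) - pairing w (u (N + m)%N))).
    move=> m; rewrite -pairingB.
    rewrite (pairing_ext _ (f' := u n - u (N + m)%N)); last by move=> x; rewrite hfunB.
    rewrite (le_trans (bounded_by_hn _ _))// ler_wpM2r ?nrm_ge0//.
    by rewrite -rn_hker hN// leq_addr.
  apply: rcvgB; first exact: rcvg_cst.
  move=> d /(rcvg_pairing w hl)[M hM]; exists M => m Mm; apply: hM.
  by rewrite (leq_trans Mm)// leq_addl.
have lH : in_closure K l.
  move=> e e0; have e20 : 0 < e / 2 by rewrite divr_gt0.
  have [N hN] := wl _ e20; have [v hv] := hfunP (u N) e20; exists v => w.
  rewrite (le_trans (rn_triangle (pairing w (u N)) _ _))//.
  by rewrite (splitr e) mulrDl lerD// rnBC; exact: hN.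
exists (HKer lH) => e e0; have [N hN] := wl _ e0; exists N => n Nn.
rewrite rn_hker; apply: hn_le; first exact: ltW.
move=> w; rewrite (pairing_ext _ (f' := fun x => u n x - l x)).
  by rewrite pairingB hN.
by move=> x; rewrite hfunB.
Qed.

HB.instance Definition _ := Uniform_isComplete.Build H hker_complete.

Lemma hractDl f g (b : B) : hract (f + g) b = hract f b + hract g b.
Proof. by apply: hker_eq => x /=; rewrite mulrDl. Qed.

Lemma hractDr f (b c : B) : hract f (b + c) = hract f b + hract f c.
Proof. by apply: hker_eq => x /=; rewrite mulrDr. Qed.

Lemma hractZl (z : R[i]) f (b : B) : hract (z *: f) b = z *: hract f b.
Proof. by apply: hker_eq => x /=; rewrite scAl. Qed.

Lemma hractZr (z : R[i]) f (b : B) : hract f (z *: b) = z *: hract f b.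
Proof. by apply: hker_eq => x /=; rewrite scAr. Qed.

Lemma hractM f (b c : B) : hract f (b * c) = hract (hract f b) c.
Proof. by apply: hker_eq => x /=; rewrite mulrA. Qed.

Lemma hract1 f : hract f 1 = f.
Proof. by apply: hker_eq => x /=; rewrite mulr1. Qed.

Lemma hnorm_hinner f : `|f| ^+ 2 = `|hinner f f|.
Proof. by rewrite !rnE rn_hker -hn_sqr -rmorphXn. Qed.

HB.instance Definition _ := isHilbertModule.Build R B H
  hractDl hractDr hractZl hractZr hractM hract1
  hinnerDr hinnerZr hinner_ract hinner_star hinner_ge0 hnorm_hinner.

End HkerModule.

(** * The kernel of a family of completely positive maps *)

Section CPGram.
Variables (R : realType) (N B : cstarAlgType R) (psi : {linear N -> B}).
Hypothesis psiCP : completely_positive_on setT psi.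

(** The matrix of the products [star (S i) * S j] is [mxstar q *m q] for the matrix
    [q] whose first row is [S] and whose other rows vanish. *)
Lemma cp_gram n (S : 'I_n -> N) : exists r : 'M[B]_n,
  forall i j, psi (star (S i) * S j) = \sum_k star (r k i) * r k j.
Proof.
case: n S => [|n] S; first by exists 0 => -[].
pose q : 'M[N]_n.+1 := \matrix_(k, j) (if k == ord0 then S j else 0).
have [//||r hr] := psiCP (p := mxstar q *m q); first by exists q.
exists r => i j; have /matrixP/(_ i j) := hr; rewrite mxE [RHS]mxE => e.
transitivity (psi ((mxstar q *m q) i j)).
  congr (psi _); rewrite mxE (bigD1 ord0)//= mxstarE !mxE eqxx big1 ?addr0//.
  by move=> k /negPf k0; rewrite mxstarE !mxE k0 mulr0.
by rewrite e; apply: eq_bigr => k _; rewrite mxstarE.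
Qed.

Lemma cp_star (S T : N) : star (psi (star S * T)) = psi (star T * S).
Proof.
have [r hr] := cp_gram (fun i : 'I_2 => if i == ord0 then S else T).
have := hr ord0 ord_max; have := hr ord_max ord0; rewrite /= => -> ->.
rewrite star_sum; apply: eq_bigr => k _.
by rewrite star_mul starK.
Qed.

Lemma cp_form_pos n (S : 'I_n -> N) (b : 'I_n -> B) :
  cpos (\sum_i \sum_j star (b i) * (psi (star (S i) * S j) * b j)).
Proof.
have [r hr] := cp_gram S.
have -> : \sum_i \sum_j star (b i) * (psi (star (S i) * S j) * b j) =
    \sum_k star (\sum_i r k i * b i) * (\sum_j r k j * b j).
  rewrite [RHS](eq_bigr (fun k => \sum_i \sum_j
      star (b i) * (star (r k i) * r k j * b j))); last first.
    move=> k _; rewrite star_sum mulr_suml; apply: eq_bigr => i _.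
    rewrite mulr_sumr; apply: eq_bigr => j _.
    by rewrite star_mul !mulrA.
  rewrite [RHS]exchange_big; apply: eq_bigr => i _.
  rewrite [RHS]exchange_big; apply: eq_bigr => j _.
  by rewrite hr mulr_suml mulr_sumr.
by apply: cpos_sum => k _; exact: cpos_star_mul.
Qed.

End CPGram.

Section CPKernel.
Variables (R : realType) (N B : cstarAlgType R).

(** The index set is [nat] so that the components of a vector can be summed in
    order. *)
Record cp_family := CPFamily {
  cpf :> nat -> {linear N -> B};
  cpfP : forall i, completely_positive_on setT (cpf i) }.

Variable Psi : cp_family.
Local Notation G := (nat * N)%type.

(** The kernel of the direct sum over [i] of the modules that the
    Gelfand-Naimark-Segal construction attaches to the maps [Psi i].  The point
    [(i, S)] stands for the image of [S] in the [i]-th summand. *)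
Definition cp_kfun (x y : G) : B :=
  if x.1 == y.1 then Psi x.1 (star x.2 * y.2) else 0.

Lemma cp_kfun_star x y : star (cp_kfun x y) = cp_kfun y x.
Proof.
rewrite /cp_kfun eq_sym; case: eqP => [->|_]; last by rewrite star0.
by rewrite cp_star//; exact: cpfP.
Qed.

Lemma index_bound (u : seq (G * B)) :
  exists L, forall i : 'I_(size u), ((tnth (in_tuple u) i).1.1 < L)%N.
Proof.
exists (\max_(i < size u) (tnth (in_tuple u) i).1.1).+1 => i.
by rewrite ltnS (leq_bigmax i).
Qed.

(** The form splits over the indices, and each summand is positive by
    [cp_form_pos], where the terms of other indices are replaced by 0. *)
Lemma cp_kfun_pos u : cpos (form cp_kfun u u).
Proof.
have [L hL] := index_bound u.
pose x i := tnth (in_tuple u) i.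
pose S (l : 'I_L) i : N := if (x i).1.1 == l then (x i).1.2 else 0.
have -> : form cp_kfun u u = \sum_(l < L) \sum_i \sum_j
    star (x i).2 * (Psi l (star (S l i) * S l j) * (x j).2).
  rewrite [RHS]exchange_big /= /form /pairing [LHS]big_tnth.
  apply: eq_bigr => i _.
  rewrite [RHS]exchange_big /= /span_fun [X in _ * X = _]big_tnth mulr_sumr.
  apply: eq_bigr => j _.
  rewrite -/(x i) -/(x j) -mulr_sumr -mulr_suml; congr (_ * (_ * _)).
  rewrite (bigD1 (Ordinal (hL i)))//= big1 ?addr0.
    rewrite /cp_kfun /S /= eqxx eq_sym; case: eqP => // _.
    by rewrite mulr0 linear0.
  move=> l li; rewrite /S; case: eqP => [il|_].
    by move: li; rewrite -(inj_eq val_inj) /= -il eqxx.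
  by rewrite star0 mul0r linear0.
apply: cpos_sum => l _; apply: (cp_form_pos (@cpfP Psi l)).
Qed.

Definition cp_kernel : pos_kernel G B := PosKernel cp_kfun_star cp_kfun_pos.

Local Notation K := cp_kernel.
Local Notation H := (hker cp_kernel).

Definition lmulG (T : N) (x : G) : G := (x.1, T * x.2).

Definition lmul_seq (T : N) (u : seq (G * B)) := [seq (lmulG T x.1, x.2) | x <- u].

Lemma pairing_lmul T u f : pairing (lmul_seq T u) f = pairing u (f \o lmulG T).
Proof. by rewrite /pairing big_map. Qed.

Lemma cp_kfun_lmul T x y : K (lmulG T x) y = K x (lmulG (star T) y).
Proof.
by rewrite /= /cp_kfun /=; case: eqP => // _; rewrite star_mul mulrA.
Qed.

Lemma span_lmul T u x : span_fun K (lmul_seq T u) x = span_fun K u (lmulG (star T) x).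
Proof.
rewrite /span_fun big_map; apply: eq_bigr => y _.
by rewrite cp_kfun_lmul starK.
Qed.

Lemma form_lmul T u w : form K u (lmul_seq T w) = form K (lmul_seq (star T) u) w.
Proof.
by rewrite /form pairing_lmul; apply: pairing_ext => x; rewrite span_lmul.
Qed.

(** Write the positive element [rn T ^+ 2 - star T * T] as [c * c]; the difference of
    the two squared norms is the form at the formal sum multiplied by [c]. *)
Lemma nrm_lmul T u : nrm K (lmul_seq T u) <= rn T * nrm K u.
Proof.
rewrite -(ler_pXn2r (_ : 0 < 2)%N) ?nnegrE ?mulr_ge0 ?rn_ge0 ?nrm_ge0//.
rewrite exprMn !nrm_sqr -rnZp ?sqr_ge0//; apply: cpos_mono; first exact: kfun_pos.
have /cpos_sqrt[c [sc _ cc _]] : cpos ((rn T ^+ 2)%:C *: (1 : N) - star T * T).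
  by apply: cpos_le_sub; rewrite ?star_mul ?starK// rn_star_mul.
have := kfun_pos K (lmul_seq c u); congr cpos.
rewrite {1}/form pairing_lmul /form pairing_lmul -pairingZ -pairingB.
apply: pairing_ext => x; rewrite /= !span_lmul /span_fun scaler_sumr -sumrB.
apply: eq_bigr => y _; rewrite scAl -mulrBl; congr (_ * _).
rewrite /= /cp_kfun /=; case: eqP => [_|_]; last by rewrite scaler0 subr0.
rewrite -linearZ -linearB; congr (Psi _ _).
rewrite !star_mul !starK sc -(mulrA _ c c) cc mulrBr mulrBl -scAr -scAl mulr1.
by rewrite !mulrA.
Qed.

Lemma in_closure_lmul T f : in_closure K f -> in_closure K (f \o lmulG T).
Proof.
move=> hf e e0; have t1 : 0 < rn T + 1 by rewrite ltr_wpDl ?rn_ge0.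
have [u fu] := hf _ (divr_gt0 e0 t1); exists (lmul_seq (star T) u) => w.
rewrite -pairing_lmul form_lmul starK (le_trans (fu _))//.
rewrite (le_trans (ler_wpM2l (ltW (divr_gt0 e0 t1)) (nrm_lmul _ _)))//.
rewrite mulrA ler_wpM2r ?nrm_ge0// mulrAC ler_pdivrMr// ler_wpM2l ?(ltW e0)//.
by rewrite lerDl.
Qed.

(** The inner product of the kernel function at [x] with the image of [f] under [T]
    is that of the kernel function at [lmulG (star T) x] with [f]. *)
Definition hact (T : N) (f : H) : H := HKer (in_closure_lmul (star T) (hfunP f)).

Lemma approx_lmul T (f : H) u e : 0 <= e -> approx K f u e ->
  approx K (hact T f) (lmul_seq T u) (e * rn T).
Proof.
move=> e0 fu w; rewrite -pairing_lmul form_lmul (le_trans (fu _))//.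
by rewrite -mulrA ler_wpM2l// -(rn_star T) nrm_lmul.
Qed.

Lemma hact_star T (f g : H) : hinner (hact T f) g = hinner f (hact (star T) g).
Proof.
have e0 n : 0 <= n.+1%:R^-1 * rn T by rewrite mulr_ge0 ?rn_ge0 ?invr_ge0.
have i0 (n : nat) : 0 <= n.+1%:R^-1 :> R by rewrite invr_ge0.
have := hinner_cvg_approx g e0 (fun n => approx_lmul T (i0 n) (apxP f n)).
have t1 : 0 < rn T + 1 by rewrite ltr_wpDl ?rn_ge0.
move=> H0; apply: rcvg_uniq (H0 _) _.
  move=> d d0; have [M hM] := invn_small (divr_gt0 d0 t1); exists M => n /hM.
  rewrite ler_pdivlMr// => h; rewrite (le_trans _ h)// ler_wpM2l// lerDl ler01.
  by [].
apply: rcvg_near (hinner_cvg f (hact (star T) g)); exists 0%N => n _.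
by rewrite pairing_lmul /= starK.
Qed.

Lemma hact_bounded T (f : H) : hn (hact T f) <= rn T * hn f.
Proof.
apply: hn_le; first by rewrite mulr_ge0 ?rn_ge0 ?hn_ge0.
move=> w; rewrite -pairing_lmul (le_trans (bounded_by_hn _ _))//.
by rewrite [rn T * _]mulrC -mulrA ler_wpM2l ?hn_ge0// -(rn_star T) nrm_lmul.
Qed.

Lemma span_cvg (f : H) x : rcvg (fun n => span_fun K (apx f n) x) (f x).
Proof.
have n1 : 0 < nrm K [:: (x, 1)] + 1 by rewrite ltr_wpDl ?nrm_ge0.
move=> e e0; have [M hM] := invn_small (divr_gt0 e0 n1); exists M => n /hM.
rewrite ler_pdivlMr// => h; rewrite (le_trans _ h)// rnBC.
have := apxP f n [:: (x, 1)]; rewrite /form /pairing !big_seq1 /= star1 !mul1r.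
by move/le_trans; apply; rewrite ler_wpM2l ?invr_ge0// lerDl ler01.
Qed.

Lemma span_fun_semilinear u i (z : R[i]) S S' :
  span_fun K u (i, z *: S + S') = z^*%R *: span_fun K u (i, S) + span_fun K u (i, S').
Proof.
rewrite /span_fun scaler_sumr -big_split; apply: eq_bigr => y _ /=.
rewrite /cp_kfun /=; case: eqP => _; last by rewrite !mul0r scaler0 add0r.
by rewrite starD starZ mulrDl -scAl linearD linearZ mulrDl scAl.
Qed.

(** The kernel is conjugate linear in the second component of its first argument,
    and this passes to the closure.  It is what makes [hact] linear in [T]. *)
Lemma hker_semilinear (f : H) i (z : R[i]) S S' :
  f (i, z *: S + S') = z^*%R *: f (i, S) + f (i, S').
Proof.
apply: rcvg_uniq (span_cvg f _) _.
apply: rcvg_near (rcvgD (rcvgZ _ (span_cvg f (i, S))) (span_cvg f (i, S'))).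
by exists 0%N => n _; rewrite span_fun_semilinear.
Qed.

Lemma hactDl S T (f : H) : hact (S + T) f = hact S f + hact T f.
Proof.
apply: hker_eq => -[i U]; rewrite /= /lmulG /= starD mulrDl.
by have := hker_semilinear f i 1 (star S * U) (star T * U); rewrite rmorph1 !scale1r.
Qed.

Lemma hactZl (z : R[i]) T (f : H) : hact (z *: T) f = z *: hact T f.
Proof.
apply: hker_eq => -[i U]; rewrite /= /lmulG /= starZ -scAl.
have := hker_semilinear f i z^*%R (star T * U) 0; rewrite conjCK addr0 => ->.
have := hker_semilinear f i 1 0 0; rewrite rmorph1 !scale1r addr0 => /eqP.
by rewrite addrC -subr_eq subrr eq_sym => /eqP ->; rewrite addr0.
Qed.

Lemma hactM S T (f : H) : hact (S * T) f = hact S (hact T f).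
Proof. by apply: hker_eq => -[i U]; rewrite /= /lmulG /= star_mul mulrA. Qed.

Lemma hact1 (f : H) : hact 1 f = f.
Proof. by apply: hker_eq => -[i U]; rewrite /= /lmulG /= star1 mul1r. Qed.

End CPKernel.

(** * Vectors with infinitely many components *)

Lemma half_pow_small (R : realType) (e : R) : 0 < e ->
  exists N, forall n, (N <= n)%N -> (2^-1) ^+ n <= e.
Proof.
move=> /invn_small[N hN]; exists N => n /hN; apply: le_trans.
rewrite exprVn lef_pV2 ?posrE ?exprn_gt0 ?ltr0Sn//.
by rewrite -natrX ler_nat ltn_expl.
Qed.

Lemma half_pow_sum (R : realType) a L : (a <= L)%N ->
  \sum_(a <= i < L) (2^-1 : R) ^+ i = 2 * (2^-1) ^+ a - 2 * (2^-1) ^+ L.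
Proof.
move=> /subnKC <-; elim: (L - a)%N => [|k IH].
  by rewrite addn0 big_geq// subrr.
by rewrite addnS big_nat_recr ?leq_addr//= IH exprS; lra.
Qed.

Section DirectSumVectors.
Variables (R : realType) (N B : cstarAlgType R) (Psi : cp_family N B).
Local Notation K := (cp_kernel Psi).
Local Notation G := (nat * N)%type.
Variables (T : nat -> N) (M : R).
Hypothesis M0 : 0 <= M.
Hypothesis hT : forall i, rn (Psi i (star (T i) * T i)) <= M * (2^-1) ^+ i.

Definition trunc a L : seq (G * B) := [seq ((i, T i), 1) | i <- index_iota a L].

Lemma span_trunc a L i S : span_fun K (trunc a L) (i, S) =
  if (a <= i < L)%N then Psi i (star S * T i) else 0.
Proof.
rewrite /span_fun big_map; case: ifPn => h.
  rewrite (bigD1_seq i) ?mem_index_iota ?iota_uniq//= /cp_kfun /= eqxx mulr1.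
  by rewrite big1 ?addr0// => j /negPf ji; rewrite eq_sym ji mul0r.
rewrite big_seq big1// => j; rewrite mem_index_iota /= /cp_kfun /= => hj.
by case: eqP => [ij|_]; [rewrite ij hj in h | rewrite mul0r].
Qed.

Lemma pairing_trunc a L f : pairing (trunc a L) f = \sum_(a <= i < L) f (i, T i).
Proof. by rewrite /pairing big_map; apply: eq_bigr => i _; rewrite star1 mul1r. Qed.

Lemma nrm_trunc a L : nrm K (trunc a L) ^+ 2 <= M * (2 * (2^-1) ^+ a).
Proof.
have [aL|La] := leqP a L; last first.
  rewrite nrm_sqr /form pairing_trunc big_geq ?rn0; last exact: ltnW.
  by rewrite !mulr_ge0// exprn_ge0// invr_ge0.
rewrite nrm_sqr /form pairing_trunc (le_trans (rn_sum _ _ _))//.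
rewrite (@le_trans _ _ (\sum_(a <= i < L) M * (2^-1) ^+ i))//.
  rewrite [leLHS]big_nat [leRHS]big_nat; apply: ler_sum => i hi.
  by rewrite span_trunc hi.
rewrite -mulr_sumr half_pow_sum// ler_wpM2l// gerBl.
by rewrite mulr_ge0// exprn_ge0// invr_ge0.
Qed.

(** The function that the vector with components [T i] must be.  Given in closed
    form, it only remains to see that it lies in the closure, for which [trunc]
    provides the approximants. *)
Definition vec_fun (x : G) : B := Psi x.1 (star x.2 * T x.1).

(** Against a given formal sum [w], whose indices are bounded, [vec_fun] agrees with
    a longer truncation; the difference of two truncations has a norm bounded by
    the tail of a geometric series. *)
Lemma approx_vec a :
  approx K vec_fun (trunc 0 a) (Num.sqrt (M * (2 * (2^-1) ^+ a))).
Proof.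
move=> w; have [L hL] := index_bound w.
pose L' := maxn a L.
have -> : pairing w vec_fun = form K w (trunc 0 L').
  rewrite /form /pairing [LHS]big_tnth [RHS]big_tnth.
  apply: eq_bigr => i _; congr (_ * _).
  case: (tnth _ i) (hL i) => -[j S] b /= jL.
  by rewrite span_trunc /= (leq_trans jL)// leq_maxr.
have -> : form K w (trunc 0 L') - form K w (trunc 0 a) = form K w (trunc a L').
  rewrite /form -pairingB; apply: pairing_ext => -[j S].
  rewrite !span_trunc /=; case: (ltnP j a) => ja /=.
    by rewrite (leq_trans ja) ?leq_maxl// subrr.
  by rewrite subr0.
rewrite (le_trans (form_cauchy_schwarz _ _ _))// mulrC ler_wpM2r ?nrm_ge0//.
by rewrite -(ger0_norm (nrm_ge0 _ _)) -sqrtr_sqr ler_wsqrtr// nrm_trunc.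
Qed.

Lemma approx_vec_small (e : R) : 0 < e ->
  exists N, forall a, (N <= a)%N -> Num.sqrt (M * (2 * (2^-1) ^+ a)) <= e.
Proof.
move=> e0; have d0 : 0 < e ^+ 2 / (2 * (M + 1)).
  by rewrite divr_gt0 ?exprn_gt0// mulr_gt0// ltr_wpDl.
have [L hL] := half_pow_small d0; exists L => a /hL.
rewrite ler_pdivlMr ?mulr_gt0 ?ltr_wpDl// => h.
rewrite -(ger0_norm (ltW e0)) -sqrtr_sqr ler_wsqrtr// (le_trans _ h)//.
have : 0 <= (2^-1 : R) ^+ a by rewrite exprn_ge0// invr_ge0.
by move: (_ ^+ a) => x; nra.
Qed.

Lemma in_closure_vec : in_closure K vec_fun.
Proof.
move=> e /approx_vec_small[a ha]; exists (trunc 0 a) => w.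
by rewrite (le_trans (approx_vec _ _))// ler_wpM2r ?nrm_ge0// ha.
Qed.

Definition vec : hker K := HKer in_closure_vec.

Lemma hinner_vec_single (g : hker K) i :
  (forall j, j != i -> g (j, T j) = 0) -> hinner vec g = g (i, T i).
Proof.
move=> g0.
have cv := @hinner_cvg_approx _ _ _ _ vec g _ _ (fun a => sqrtr_ge0 _) approx_vec
  approx_vec_small.
apply: rcvg_uniq cv _.
apply: rcvg_near (rcvg_cst _); exists i.+1 => n hn.
rewrite pairing_trunc (bigD1_seq i) ?mem_index_iota ?iota_uniq//=.
by rewrite big1 ?addr0.
Qed.

End DirectSumVectors.

(** * The correspondence and the decomposition *)

Section Correspondence.
Variables (R : realType) (A B : cstarAlgType R) (Psi : cp_family (mxalg A 2) B).

Let i0 : 'I_2 := ord0.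
Let i1 : 'I_2 := ord_max.

(** A separate name for the same module, because the left action of [A] is the
    restriction along [dg] of the action of the matrix algebra, and [A] cannot be
    read off the type of the module. *)
Definition corr : Type := hker (cp_kernel Psi).

HB.instance Definition _ := HilbertModule.copy corr (hker (cp_kernel Psi)).

Definition dg (a : A) : mxalg A 2 := a%:M.

Lemma dgD a b : dg (a + b) = dg a + dg b.
Proof. exact: raddfD. Qed.

Lemma dgZ (z : R[i]) a : dg (z *: a) = z *: dg a.
Proof. by apply/matrixP => i j; rewrite !mxE scalerMnr. Qed.

Lemma dgM a b : dg (a * b) = dg a * dg b.
Proof. exact: scalar_mxM. Qed.

Lemma dg_star a : star (dg a) = dg (star a).
Proof.
apply/matrixP => i j; rewrite [LHS]mxstarE !mxE eq_sym.
by case: (_ == _); rewrite // star0.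
Qed.

Definition corr_lact (a : A) (f : corr) : corr := hact (dg a) f.

Lemma corr_lactD (a b : A) f : corr_lact (a + b) f = corr_lact a f + corr_lact b f.
Proof. by rewrite /corr_lact dgD hactDl. Qed.

Lemma corr_lactZ (z : R[i]) (a : A) f : corr_lact (z *: a) f = z *: corr_lact a f.
Proof. by rewrite /corr_lact dgZ hactZl. Qed.

Lemma corr_lactM (a b : A) f : corr_lact (a * b) f = corr_lact a (corr_lact b f).
Proof. by rewrite /corr_lact dgM hactM. Qed.

Lemma corr_lact1 f : corr_lact 1 f = f.
Proof. exact: hact1. Qed.

Lemma corr_lact_star (a : A) (f g : corr) :
  inner (corr_lact a f) g = inner f (corr_lact (star a) g).
Proof. by rewrite /corr_lact -dg_star; exact: hact_star. Qed.

HB.instance Definition _ := isCorrespondence.Build R A B corr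
  corr_lactD corr_lactZ corr_lactM corr_lact1 corr_lact_star.

Definition e21 : mxalg A 2 := munit i1 i0 1.

Definition corr_e21 (f : corr) : corr := hact e21 f.

(** Hence the action of [e21] is a module map for [A]. *)
Lemma e21_comm a : e21 * dg a = dg a * e21.
Proof.
apply/matrixP => i j; rewrite [LHS]mxE [RHS]mxE !big_ord2 !mxE.
by case: i j => [[|[|//]] ?] [[|[|//]] ?] /=;
  rewrite ?(mulr0n, mulr1n, mulr0, mul0r, mulr1, mul1r, addr0, add0r).
Qed.

Lemma rn_e21 : rn e21 <= 1.
Proof.
rewrite rn_mxalg (le_trans (mxnorm_le_sum _))// !big_ord2 !mxE /=.
by rewrite rn0 !addr0 !add0r rn1.
Qed.

Lemma corr_e21_adjointable : adjointable corr_e21.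
Proof. by exists (hact (star e21)) => f g; exact: hact_star. Qed.

Lemma corr_e21_contraction (f : corr) : `|corr_e21 f| <= `|f|.
Proof.
rewrite !rnE lecR; have := hact_bounded e21 f => /le_trans; apply.
by rewrite -[leRHS]mul1r ler_wpM2r ?hn_ge0// rn_e21.
Qed.

Lemma corr_e21_lact a (f : corr) : corr_e21 (lact a f) = lact a (corr_e21 f).
Proof.
rewrite -[LHS](hactM e21 (dg a) f) -[RHS](hactM (dg a) e21 f).
by congr (hact _ f); exact: e21_comm.
Qed.

Definition dmx (s t : R) : mxalg A 2 :=
  \matrix_(i, j) (if i == j then (if i == i0 then s else t)%:C *: (1 : A) else 0).

Lemma dmx_sqr s t : star (dmx s t) * dmx s t =
  (s ^+ 2)%:C *: munit i0 i0 1 + (t ^+ 2)%:C *: munit i1 i1 1.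
Proof.
apply/matrixP => i j; rewrite [LHS]mxE big_ord2 !mxstarE !mxE.
by case: i j => [[|[|//]] ?] [[|[|//]] ?] /=;
  rewrite ?(star0, mulr0, mul0r, addr0, add0r, scaler0)// starZr star1 -scAl;
  rewrite mul1r scaleCM.
Qed.

(** For the action of [e21], only the first diagonal entry of the left vector and the
    second one of the right vector matter.  So a vector may carry both entries
    without producing further terms. *)
Lemma dmx_corner s t s' t' a : star (dmx s t) * star e21 * dg a * dmx s' t' =
  (s * t')%:C *: munit i0 i1 a.
Proof.
apply/matrixP => i j.
rewrite [LHS]mxE big_ord2 ![(_ * dg a) _ _]mxE !big_ord2 ![(_ * star e21) _ _]mxE.
rewrite !big_ord2 !mxstarE !mxE.
case: i j => [[|[|//]] ?] [[|[|//]] ?] /=;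
  rewrite ?(star0, star1, starZr, mulr0n, mulr1n, mulr0, mul0r, mulr1, mul1r)
    ?(addr0, add0r, mulr0, mul0r, scaler0)//.
by rewrite -scAl mul1r -scAr mulr1 scaleCM mulrC.
Qed.

Lemma corr_e21_vec S T M M' (M0 : 0 <= M) (M0' : 0 <= M') hS hT (a : A) i :
  (forall j, j != i -> Psi j (star (S j) * star e21 * dg a * T j) = 0) ->
  inner (corr_e21 (vec (Psi := Psi) (T := S) M0 hS) : corr)
        (lact a (vec (Psi := Psi) (T := T) M0' hT : corr)) =
  Psi i (star (S i) * star e21 * dg a * T i).
Proof.
move=> H0; rewrite [LHS](hact_star e21).
have E j : (hact (star e21) (hact (dg a) (vec M0' hT)) : hker _) (j, S j) =
    Psi j (star (S j) * star e21 * dg a * T j).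
  by rewrite /= /vec_fun /= !star_mul !starK.
by rewrite -E; apply: hinner_vec_single => j /H0; rewrite -E.
Qed.

End Correspondence.

(** Used with [e = 1] for the first coefficient of a vector and with
    [e = pair_const i] for the second one. *)
Lemma damped_square_le (R : realType) (e h s : R) : 0 < h -> h <= 1 -> 0 < s ->
  e ^+ 2 <= s -> (e * h / s) ^+ 2 * s <= h.
Proof.
move=> h0 h1 s0 es.
have -> : (e * h / s) ^+ 2 * s = h * (h * (e ^+ 2 / s)) by field; rewrite gt_eqF.
rewrite -[leRHS]mulr1 ler_wpM2l ?(ltW h0)// mulr_ile1 ?(ltW h0)//.
  by rewrite divr_ge0 ?sqr_ge0 ?(ltW s0).
by rewrite ler_pdivrMr// mul1r.
Qed.

Section Assembly.
Variables (R : realType) (A B : cstarAlgType R) (X : Type).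
Variable k : X -> X -> boundedLinear A B.
Variable c : X -> nat.
Hypothesis cI : injective c.
Hypothesis hB : injective_cstar B.
Hypothesis hk : completely_bounded_kernel k.

Let i0 : 'I_2 := ord0.
Let i1 : 'I_2 := ord_max.
Let N := mxalg A 2.

Lemma pair_extension_exists (p : X * X) : exists d : {linear N -> B} * R,
  completely_positive_on setT d.1 /\
  forall a, k p.1 p.2 a = d.2%:C *: d.1 (munit i0 i1 a).
Proof.
have [C hC] := completely_bounded_kernel_entry p.1 p.2 hk.
by have [psi [d [psiCP psiE]]] := off_diagonal_extension hB hC; exists (psi, d).
Qed.

Definition pair_extension p := sval (cid (pair_extension_exists p)).

Lemma pair_extensionP p : completely_positive_on setT (pair_extension p).1 /\
  forall a, k p.1 p.2 a =
    (pair_extension p).2%:C *: (pair_extension p).1 (munit i0 i1 a).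
Proof. by rewrite /pair_extension; case: cid. Qed.

Definition code (p : X * X) : nat := pickle (c p.1, c p.2).

Lemma code_inj : injective code.
Proof. by move=> [x y] [x' y'] /(pcan_inj pickleK)[/cI -> /cI ->]. Qed.

Definition decode (i : nat) : option (X * X) :=
  if pselect (exists p, code p = i) is left h then Some (sval (cid h)) else None.

Lemma decodeP i p : decode i = Some p -> code p = i.
Proof. by rewrite /decode; case: pselect => // h [<-]; case: cid. Qed.

Lemma codeK p : decode (code p) = Some p.
Proof.
rewrite /decode; case: pselect => [h|[]]; last by exists p.
by congr Some; case: cid => q /= /code_inj.
Qed.

Definition cp_of (i : nat) : {linear N -> B} :=
  if decode i is Some p then (pair_extension p).1 else \0.

Lemma cp_ofP i : completely_positive_on setT (cp_of i).
Proof.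
rewrite /cp_of; case: (decode i) => [p|]; first by have [] := pair_extensionP p.
move=> n p _ _; exists 0; apply/matrixP => s t.
by rewrite !mxE big1// => j _; rewrite !mxE mulr0.
Qed.

Definition Psi : cp_family N B := CPFamily cp_ofP.

Definition pair_const (i : nat) : R :=
  if decode i is Some p then (pair_extension p).2 else 1.

(** A bound, at least 1, for all that the coefficients in the [i]-th summand have to
    compensate: the squared norms of both vectors and the square of the constant. *)
Definition mass (i : nat) : R :=
  1 + pair_const i ^+ 2 + rn (Psi i (munit i0 i0 1)) + rn (Psi i (munit i1 i1 1)).

(** In the summand of [(x, y)] the vector of [x] is multiplied by the weight and that
    of [y] divided by it, which leaves their product unchanged.  The weight is
    small if [x] comes first in the enumeration and large if [y] does.  So a
    component of the vector of [x] can be large only if the other point of the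
    pair comes no later than [x], which happens finitely often. *)
Definition weight (i : nat) : R :=
  if decode i is Some p then
    if (c p.1 <= c p.2)%N then (2^-1) ^+ i / mass i else mass i / (2^-1) ^+ i
  else 1.

Definition coefl (x : X) (i : nat) : R :=
  if decode i is Some p then if c p.1 == c x then weight i else 0 else 0.

Definition coefr (x : X) (i : nat) : R :=
  if decode i is Some p then if c p.2 == c x then pair_const i / weight i else 0 else 0.

Definition sq_mass (x : X) (i : nat) : R :=
  (coefl x i ^+ 2 + coefr x i ^+ 2) * mass i.

Lemma half_pow_gt0 i : 0 < (2^-1 : R) ^+ i.
Proof. by rewrite exprn_gt0// invr_gt0. Qed.

Lemma half_pow_le1 i : (2^-1 : R) ^+ i <= 1.
Proof. by rewrite exprn_ile1// ?invr_ge0// invf_le1// ler1n. Qed.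

Lemma mass_ge1 i : 1 <= mass i.
Proof.
rewrite /mass -!addrA lerDl !addr_ge0// ?rn_ge0//; exact: sqr_ge0.
Qed.

Lemma mass_ge_const i : pair_const i ^+ 2 <= mass i.
Proof.
by rewrite /mass [1 + _]addrC -!addrA lerDl !addr_ge0 ?rn_ge0.
Qed.

Lemma sq_mass_ge0 x i : 0 <= sq_mass x i.
Proof.
apply: mulr_ge0; first by rewrite addr_ge0 ?sqr_ge0.
exact: le_trans ler01 (mass_ge1 i).
Qed.

Lemma weight_gt0 i : 0 < weight i.
Proof.
have s0 : 0 < mass i := lt_le_trans ltr01 (mass_ge1 i).
rewrite /weight; case: (decode i) => [p|//].
by case: ifP => _; rewrite divr_gt0// half_pow_gt0.
Qed.

(** The excluded indices include those of all pairs in which both points come no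
    later than [x]. *)
Lemma sq_mass_small x i :
  ~~ [exists pq : 'I_(c x).+1 * 'I_(c x).+1, pickle (pq.1 : nat, pq.2 : nat) == i] ->
  sq_mass x i <= (2^-1) ^+ i.
Proof.
move=> hi; rewrite /sq_mass /coefl /coefr; set h := _ ^+ i.
have h0 : 0 < h by exact: half_pow_gt0.
have h1 : h <= 1 by exact: half_pow_le1.
have s1 := mass_ge1 i; have sc := mass_ge_const i.
have s0 : 0 < mass i by exact: lt_le_trans s1.
rewrite /weight -/h; case di : (decode i) => [[y z]|]; last first.
  by rewrite expr0n addr0 mul0r ltW.
have hyz : (c x < c y)%N || (c x < c z)%N.
  apply: contraR hi; rewrite negb_or -!leqNgt => /andP[hy hz].
  apply/existsP; exists (Ordinal (hy : (c y < (c x).+1)%N),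
                         Ordinal (hz : (c z < (c x).+1)%N)).
  by rewrite /= -(decodeP di).
rewrite /=; case: eqP => [yx|yx]; case: eqP => [zx|zx].
- by move: hyz; rewrite yx zx ltnn.
(* [x] is the first point and comes first, so the weight is small *)
- move: hyz; rewrite -yx ltnn /= => /ltnW ->.
  rewrite expr0n addr0 -[h / _]mul1r mulrA; apply: damped_square_le => //.
  by rewrite expr1n.
(* [x] is the second point and comes first, so the weight is large *)
- move: hyz; rewrite -zx ltnn orbF [(c y <= _)%N]leqNgt => -> /=.
  by rewrite expr0n add0r invf_div mulrA; exact: damped_square_le.
- by rewrite expr0n addr0 mul0r ltW.
Qed.

(** The finitely many indices excluded in [sq_mass_small] are absorbed by the
    constant. *)
Lemma sq_mass_bound x : exists2 M, 0 <= M & forall i, sq_mass x i <= M * (2^-1) ^+ i.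
Proof.
pose F (pq : 'I_(c x).+1 * 'I_(c x).+1) : R :=
  let i := pickle (pq.1 : nat, pq.2 : nat) in sq_mass x i / (2^-1) ^+ i.
have F0 pq : 0 <= F pq by rewrite divr_ge0 ?sq_mass_ge0// ltW// half_pow_gt0.
have S0 : 0 <= \sum_pq F pq by apply: sumr_ge0.
exists (1 + \sum_pq F pq); first by rewrite addr_ge0.
move=> i; have [/existsP[pq /eqP e]|/sq_mass_small h] := boolP
  [exists pq : 'I_(c x).+1 * 'I_(c x).+1, pickle (pq.1 : nat, pq.2 : nat) == i].
  rewrite -ler_pdivrMr ?half_pow_gt0//; rewrite (bigD1 pq)//= {1}/F /= e.
  by rewrite addrCA lerDl addr_ge0// sumr_ge0.
by rewrite (le_trans h)// ler_peMl ?(ltW (half_pow_gt0 i))// lerDl.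
Qed.

Definition component (x : X) (i : nat) : N := dmx A (coefl x i) (coefr x i).

Lemma component_bound x : exists2 M, 0 <= M &
  forall i, rn (Psi i (star (component x i) * component x i)) <= M * (2^-1) ^+ i.
Proof.
have [M M0 hM] := sq_mass_bound x; exists M => // i.
rewrite (le_trans _ (hM i))// dmx_sqr linearD !linearZ/=.
rewrite (le_trans (rnD _ _))// !rnZp ?sqr_ge0// /sq_mass mulrDl lerD//.
  by rewrite ler_wpM2l ?sqr_ge0// /mass addrAC lerDr !addr_ge0 ?sqr_ge0 ?rn_ge0.
by rewrite ler_wpM2l ?sqr_ge0// /mass lerDr !addr_ge0 ?sqr_ge0 ?rn_ge0.
Qed.

Theorem kolmogorov_decomposition : has_Kolmogorov_decomposition k.
Proof.
pose M x := s2val (cid2 (component_bound x)).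
have M0 x : 0 <= M x by exact: s2valP (cid2 (component_bound x)).
have hM x i :
    rn (Psi i (star (component x i) * component x i)) <= M x * (2^-1) ^+ i.
  exact: (s2valP' (cid2 (component_bound x)) i).
exists (corr Psi : correspondence A B).
exists (fun x => vec (M0 x) (hM x) : corr Psi), (@corr_e21 R A B Psi).
split.
- exact: corr_e21_adjointable.
- exact: corr_e21_contraction.
- exact: corr_e21_lact.
move=> x y a.
rewrite (@corr_e21_vec _ _ _ Psi _ _ _ _ (M0 x) (M0 y) (hM x) (hM y) a (code (x, y))).
  rewrite /component dmx_corner linearZ /= /coefl /coefr /pair_const /cp_of.
  rewrite codeK /= !eqxx.
  rewrite mulrC divfK.
    by have [_ ->] := pair_extensionP (x, y).
  by rewrite gt_eqF// weight_gt0.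
move=> j jc; rewrite /component dmx_corner linearZ /= /coefl /coefr.
case dj : (decode j) => [[y' z']|]; last by rewrite mulr0 scale0r.
rewrite /=; case: eqP => [/cI xy|_]; last by rewrite mul0r scale0r.
case: eqP => [/cI xz|_]; last by rewrite mulr0 scale0r.
by move: jc; rewrite -(decodeP dj) xy xz eqxx.
Qed.

End Assembly.

Theorem corollary7p3 (R : realType) (X : Type) (A B : cstarAlgType R)
    (hX : countable [set: X]) (hB : injective_cstar B)
    (k : X -> X -> boundedLinear A B) (hk : completely_bounded_kernel k) :
  has_Kolmogorov_decomposition k.
Proof.
have /countable_injP[c cI] := hX.
apply: (@kolmogorov_decomposition _ _ _ _ _ c) => // x y.
by apply: cI; rewrite inE.
Qed.
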